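(* Let $X$ be a compact Kähler manifold with Kähler form $\omega$ and $E$ a holomorphic vector bundle on $X$. Let $g_t,h_t$, $t\ge 0$, be two families of Hermitian metrics on $E$ which are solutions of $$h^{-1}\partial_t h=-2i(\Lambda F-\lambda)$$ for $t\geq 0$, with $g_0\leq h_0$. Then $g_t\leq h_t$ for all $t\geq 0$.
   Context: For a Hermitian metric $h$ on $E$, $F$ is the curvature of the Chern connection of $h$ (the unique $h$-unitary connection whose $(0,1)$-part is $\overline\partial_E$); in a local holomorphic frame $F=\overline\partial(h^{-1}\partial h)$. $\Lambda$ is the adjoint of the operator $\alpha\mapsto\omega\wedge\alpha$ on forms. With $n=\dim_{\mathbb C}X$ and $\deg(E)=\int_X c_1(E)\wedge\omega^{n-1}$, the constant $\lambda$ is $\lambda=-\dfrac{2n\pi\deg(E)}{\mathrm{rk}(E)\int_X\omega^n}\,i$. Solutions are smooth families of smooth metrics. The partial order on Hermitian metrics is pointwise: $g\le h$ means $g(v,v)\le h(v,v)$ for all vectors $v$ in all fibres of $E$. *)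

(* Defs.v *)
From HB Require Import structures.
From mathcomp Require Import all_boot all_order all_algebra all_fingroup.
From mathcomp Require Import complex.
From mathcomp Require Import all_classical all_reals all_analysis.

Set Implicit Arguments.
Unset Strict Implicit.
Unset Printing Implicit Defensive.

Import Order.TTheory GRing.Theory Num.Theory.
Import numFieldNormedType.Exports.

Local Open Scope classical_set_scope.
Local Open Scope complex_scope.
Local Open Scope ring_scope.

Section Smooth.
Variables (R : realType) (V : normedModType R).

(* Directional derivative of f at p along v, the difference quotient being
   restricted to the s <> 0 with p + s v in S.  It is the ordinary one when S is
   a neighbourhood of p, and one-sided at t = 0 when S = [0, +oo[ * U. *)
Definition within_quot (S : set V) (f : V -> R) (p v : V) : set_system R :=
  (fun s : R => s^-1 * (f (p + s *: v) - f p)) @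
    within [set s : R | S (p + s *: v)] (0 : R)^'.

Definition derivable_within (S : set V) (f : V -> R) (p v : V) : Prop :=
  cvg (within_quot S f p v).

Definition derive_within (S : set V) (f : V -> R) (p v : V) : R :=
  lim (within_quot S f p v).

Fixpoint Ck_on (k : nat) (S : set V) (f : V -> R) : Prop :=
  {within S, continuous f} /\
  if k is k'.+1 then
    forall v : V, (forall p, S p -> derivable_within S f p v) /\
      Ck_on k' S (fun p => derive_within S f p v)
  else True.

Definition smooth_on (S : set V) (f : V -> R) : Prop := forall k, Ck_on k S f.

Definition csmooth_on (S : set V) (f : V -> R[i]) : Prop :=
  smooth_on S (fun p => complex.Re (f p)) /\
  smooth_on S (fun p => complex.Im (f p)).

End Smooth.

(* The pair (x, y) of real row vectors stands for the point x + i y of C^n. *)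

Notation cspace R n := ('rV[R]_n * 'rV[R]_n)%type.

Section Calculus.
Variables (R : realType) (n : nat).
Implicit Types (f : cspace R n -> R[i]) (p : cspace R n) (S : set (cspace R n)).

Definition zcoord (k : 'I_n) p : R[i] := p.1 0 k +i* p.2 0 k.

Definition cderive (v : cspace R n) f p : R[i] :=
  ('D_v (fun q => complex.Re (f q)) p) +i* ('D_v (fun q => complex.Im (f q)) p).

Definition dx (k : 'I_n) f p := cderive (delta_mx 0 k, 0) f p.
Definition dy (k : 'I_n) f p := cderive (0, delta_mx 0 k) f p.

Definition dz (k : 'I_n) f p : R[i] := 2^-1 * (dx k f p - 'i * dy k f p).
Definition dzbar (k : 'I_n) f p : R[i] := 2^-1 * (dx k f p + 'i * dy k f p).

Definition holomorphic_on S f : Prop :=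
  csmooth_on S f /\ forall p k, S p -> dzbar k f p = 0.

End Calculus.

(* Iterated Lebesgue integral over R^n; it is only applied to continuous
   functions with compact support. *)
Fixpoint int_Rn (R : realType) (n : nat) : ('rV[R]_n -> R) -> R :=
  match n with
  | 0 => fun f => f 0
  | m.+1 => fun f : 'rV[R]_(1 + m) -> R =>
      Rintegral (@lebesgue_measure R) setT
        (fun t : R => int_Rn (fun v : 'rV[R]_m => f (row_mx t%:M v)))
  end.

Definition int_Cn (R : realType) (n : nat) (f : cspace R n -> R[i]) : R[i] :=
  int_Rn (fun x => int_Rn (fun y => complex.Re (f (x, y)))) +i*
  int_Rn (fun x => int_Rn (fun y => complex.Im (f (x, y)))).

(* The atlas need not be maximal.  Second countability is omitted: it is automatic
   on compact spaces. *)
Record complexManifold (R : realType) (n : nat) := ComplexManifold {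
  mspace :> topologicalType;
  mhausdorff : hausdorff_space mspace;
  chart_idx : Type;
  chart_dom : chart_idx -> set mspace;
  chart : chart_idx -> mspace -> cspace R n;
  chartV : chart_idx -> cspace R n -> mspace;
  chart_dom_open : forall i, open (chart_dom i);
  chart_cover : forall x, exists i, chart_dom i x;
  chart_img_open : forall i, open (chart i @` chart_dom i);
  chartK : forall i x, chart_dom i x -> chartV i (chart i x) = x;
  chart_cont : forall i, {within chart_dom i, continuous (chart i)};
  chartV_cont : forall i,
    {within chart i @` chart_dom i, continuous (chartV i)};
  chart_trans : forall i j k,
    holomorphic_on (chart i @` (chart_dom i `&` chart_dom j))
      (fun p => zcoord k (chart j (chartV i p)))
}.

Section Manifold.
Variables (R : realType) (n : nat) (X : complexManifold R n).

(* A top-degree form is given by its coefficient with respect to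
   dx_1 dy_1 ... dx_n dy_n in every chart.  Its integral is computed with a
   finite partition of unity subordinate to the charts. *)
Definition is_partition_of_unity (m : nat) (c : 'I_m -> chart_idx X)
    (rho : 'I_m -> X -> R) : Prop :=
  [/\ forall k x, 0 <= rho k x,
      forall k i, smooth_on (chart i @` chart_dom i)
                    (fun p => rho k (chartV i p)),
      forall k, closure [set x | rho k x != 0] `<=` chart_dom (c k)
    & forall x, \sum_(k < m) rho k x = 1].

Definition has_integral (eta : chart_idx X -> X -> R[i]) (I : R[i]) : Prop :=
  exists m (c : 'I_m -> chart_idx X) (rho : 'I_m -> X -> R),
    is_partition_of_unity c rho /\
    I = \sum_(k < m)
          int_Cn (patch (fun=> 0) (chart (c k) @` chart_dom (c k))
            (fun p => (rho k (chartV (c k) p))%:C *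
                      eta (c k) (chartV (c k) p))).

End Manifold.

(* The matrix a stands for the (1,1)-form \sum_(j, k) a j k dz_j /\ dzbar_k at a
   point of C^n. *)

Section Forms11.
Variables (R : realType) (n : nat).
Implicit Types (w a b : 'M[R[i]]_n).

(* The form w = i \sum_(j, k) g_jk dz_j /\ dzbar_k is positive iff (g_jk) is a
   positive definite Hermitian matrix. *)
Definition positive11 w : Prop :=
  (forall j k, ((- 'i) * w j k) = ((- 'i) * w k j)^*) /\
  (forall v : 'rV[R[i]]_n, v != 0 ->
     0 < \sum_j \sum_k (- 'i) * w j k * v 0 j * (v 0 k)^*).

(* Hermitian inner product induced on (1,1)-forms by the Hermitian metric with
   fundamental form w: <dz_j, dz_l> = G l j where G is the inverse of (g_jk),
   and <dz_j /\ dzbar_k, dz_l /\ dzbar_m> = <dz_j, dz_l> <dzbar_k, dzbar_m>. *)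
Definition inner11 w a b : R[i] :=
  let G := invmx ((- 'i) *: w) in
  \sum_j \sum_k \sum_l \sum_m a j k * (b l m)^* * (G l j * G k m).

(* Adjoint of f |-> f w, from functions to (1,1)-forms. *)
Definition Lambda11 w a : R[i] := inner11 w a w.

Lemma Lambda11_adjoint w a (f : R[i]) :
  inner11 w a (f *: w) = Lambda11 w a * f^*.
Proof.
rewrite /Lambda11 /inner11 mulr_suml; apply: eq_bigr => j _.
rewrite mulr_suml; apply: eq_bigr => k _.
rewrite mulr_suml; apply: eq_bigr => l _.
rewrite mulr_suml; apply: eq_bigr => m _.
rewrite mxE rmorphM /= -!mulrA; congr (_ * _).
by rewrite mulrCA; congr (_ * _); rewrite mulrC -mulrA.
Qed.

(* Coefficient of a_1 /\ ... /\ a_n with respect to dx_1 dy_1 ... dx_n dy_n,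
   using dz_j /\ dzbar_j = - 2 i dx_j /\ dy_j. *)
Definition wedge_top (a : 'I_n -> 'M[R[i]]_n) : R[i] :=
  (- 2 * 'i) ^+ n *
  \sum_(s : 'S_n) \sum_(t : 'S_n)
    (-1) ^+ (s : bool) * (-1) ^+ (t : bool) * \prod_k a k (s k) (t k).

End Forms11.

(* kform i x is the coefficient matrix of the form at x in the chart i. *)
Record kahlerForm (R : realType) (n : nat) (X : complexManifold R n) :=
  KahlerForm {
  kform :> chart_idx X -> X -> 'M[R[i]]_n;
  kform_smooth : forall i j k,
    csmooth_on (chart i @` chart_dom i) (fun p => kform i (chartV i p) j k);
  kform_pos : forall i x, chart_dom i x -> positive11 (kform i x);
  kform_glue : forall i i' x j k, chart_dom i x -> chart_dom i' x ->
    let jac a l :=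
      dz l (fun p => zcoord a (chart i' (chartV i p))) (chart i x) in
    kform i x j k =
      \sum_a \sum_b kform i' x a b * jac a j * (jac b k)^*;
  kform_closed : forall i x j k l, chart_dom i x ->
    let w a b := fun p => kform i (chartV i p) a b in
    dz l (w j k) (chart i x) = dz j (w l k) (chart i x) /\
    dzbar l (w j k) (chart i x) = dzbar k (w j l) (chart i x)
}.

(* The topology and complex structure of the total space are those induced by the
   trivialisations.  triv_at selects one trivialisation around each point. *)

Record holBundle (R : realType) (n : nat) (X : complexManifold R n) (r : nat) :=
  HolBundle {
  fib : X -> lmodType R[i];
  triv_idx : Type;
  triv_dom : triv_idx -> set X;
  triv : triv_idx -> forall x, fib x -> 'cV[R[i]]_r;
  trivV : triv_idx -> forall x, 'cV[R[i]]_r -> fib x;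
  triv_dom_open : forall j, open (triv_dom j);
  triv_at : X -> triv_idx;
  triv_cover : forall x, triv_dom (triv_at x) x;
  triv_linear : forall j x, triv_dom j x -> linear (@triv j x);
  trivK : forall j x, triv_dom j x -> cancel (@triv j x) (@trivV j x);
  trivVK : forall j x, triv_dom j x -> cancel (@trivV j x) (@triv j x);
  triv_trans : forall i j j' (a b : 'I_r),
    holomorphic_on
      (chart i @` (chart_dom i `&` (triv_dom j `&` triv_dom j')))
      (fun p => triv j' (trivV j (chartV i p) (delta_mx b 0)) a 0)
}.

Section Bundle.
Variables (R : realType) (n r : nat) (X : complexManifold R n).
Variable E : holBundle X r.

Definition bundle_img (i : chart_idx X) (j : triv_idx E) : set (cspace R n) :=
  chart i @` (chart_dom i `&` triv_dom j).

Definition frame (j : triv_idx E) (x : X) (b : 'I_r) : fib E x :=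
  trivV j x (delta_mx b 0).

(* Matrix of a metric in a frame, with (a, b) entry h(e_b, e_a): if u and v have
   coordinate columns U and V then h(u, v) = V^* H U. *)
Definition gram (h : forall x, {dot (fib E x) for Num.conj})
    (j : triv_idx E) (x : X) : 'M[R[i]]_r :=
  \matrix_(a, b) h x (frame j x b) (frame j x a).

Record hermMetric := HermMetric {
  hmetric :> forall x, {dot (fib E x) for Num.conj};
  hmetric_smooth : forall i j a b,
    csmooth_on (bundle_img i j) (fun p => gram hmetric j (chartV i p) a b)
}.

Definition metric_le (g h : hermMetric) : Prop :=
  forall x (v : fib E x), g x v v <= h x v v.

(* Entry (a, b), in the chart i and the frame j, of
   dbar (H^-1 d H) = \sum_(k, l) - dzbar_l (H^-1 dz_k H) dz_k /\ dzbar_l. *)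
Definition curvature (h : hermMetric) (i : chart_idx X) (j : triv_idx E) (x : X)
    (a b : 'I_r) : 'M[R[i]]_n :=
  let H p := gram h j (chartV i p) in
  let dH k p := \matrix_(c, d) dz k (fun q => H q c d) p in
  \matrix_(k, l) (- dzbar l (fun p => (invmx (H p) *m dH k p) a b) (chart i x)).

Definition Lambda_curvature (w : kahlerForm X) (h : hermMetric)
    (i : chart_idx X) (j : triv_idx E) (x : X) : 'M[R[i]]_r :=
  \matrix_(a, b) Lambda11 (w i x) (curvature h i j x a b).

(* The first Chern form i / (2 pi) tr F of a metric, which represents c_1(E). *)
Definition chern_form (h : hermMetric) (i : chart_idx X) (x : X) : 'M[R[i]]_n :=
  ('i / (2 * pi)%:C) *: \sum_a curvature h i (triv_at E x) x a a.

(* \int_X c_1(E) /\ w^(n-1) does not depend on the metric representing c_1(E),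
   nor on the partition of unity. *)
Definition degree (w : kahlerForm X) : R[i] :=
  xget 0 [set d | exists h : hermMetric,
    has_integral
      (fun i x => wedge_top (fun k : 'I_n =>
         if k == 0%N :> nat then chern_form h i x else w i x)) d].

Definition kahler_volume (w : kahlerForm X) : R[i] :=
  xget 0 [set v | has_integral (fun i x => wedge_top (fun=> w i x)) v].

Definition einstein_const (w : kahlerForm X) : R[i] :=
  - ((2 * n%:R * pi%:C * degree w) / (r%:R * kahler_volume w)) * 'i.

Definition gram_dt (h : R -> hermMetric) (t : R) (j : triv_idx E) (x : X) :
    'M[R[i]]_r :=
  let D (f : R -> R) := @derive_within R R [set s | 0 <= s] f t 1 in
  \matrix_(a, b) (D (fun s => complex.Re (gram (h s) j x a b)) +i*
                  D (fun s => complex.Im (gram (h s) j x a b))).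

(* Joint smoothness on [0, +oo[ * X; the values at t < 0 are irrelevant. *)
Definition smooth_family (h : R -> hermMetric) : Prop :=
  forall i j a b,
    csmooth_on [set q : R * cspace R n | 0 <= q.1 /\ bundle_img i j q.2]
      (fun q => gram (h q.1) j (chartV i q.2) a b).

Definition hermitian_YM_flow (w : kahlerForm X) (h : R -> hermMetric) : Prop :=
  smooth_family h /\
  forall t i j x, 0 <= t -> chart_dom i x -> triv_dom j x ->
    invmx (gram (h t) j x) *m gram_dt h t j x =
    (- 2 * 'i) *: (Lambda_curvature w (h t) i j x - (einstein_const w)%:M).

End Bundle.

(* Main.v *)
(* Maximum principle.  If g <= h fails, then for some eps > 0 and C > 1 the family
   m(t) h_t with m(t) = C (1 + eps t) dominates g_t on [0, T] and touches it at some
   t > 0 in a vector v over a point x: C is the infimum of the constants for which the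
   domination is strict, and compactness of X and of the unit spheres makes strict
   domination an open condition.  Put D = m H - K, where H and K are the matrices of h
   and g in a holomorphic frame, so that D >= 0 and v^* D v = 0 at x.

   Since -2 i Lambda F is 2 sum_(k, l) G_kl dbar_k (H^-1 d_l H) with G the
   inverse of the Kaehler metric, H_t - 2 i lambda H equals
   2 sum_(k, l) G_kl (dbar_k d_l H - dbar_k H H^-1 d_l H), and likewise for K.  Fix a
   direction c of C^n, let a = d_c H v, b = d_c K v, and extend v to the holomorphic
   section s with d_c s = - H^-1 a, which makes the h-covariant derivative of s vanish
   at x.  The nonnegative function s^* D s vanishes at x, so the second-derivative test
   gives, after completing the square,
     m (v^* dbar_c d_c H v - a^* H^-1 a) - (v^* dbar_c d_c K v - b^* K^-1 b)
       >= (b - K H^-1 a)^* K^-1 (b - K H^-1 a) >= 0.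
   Summing over an eigenbasis of G, the flow equations give d/dt (v^* D v) >=
   C eps v^* H v > 0 at the touching time, whereas v^* D v >= 0 before that time and
   v^* D v = 0 at it. *)

Require Import Defs.
From HB Require Import structures.
From mathcomp Require Import all_boot all_order all_algebra all_fingroup.
From mathcomp Require Import complex spectral sesquilinear.
From mathcomp Require Import all_classical all_reals all_analysis.
From mathcomp Require Import ring lra.
Import Order.TTheory GRing.Theory Num.Theory.
Import numFieldNormedType.Exports.
Local Open Scope classical_set_scope.
Local Open Scope ring_scope.

Set Implicit Arguments.
Unset Strict Implicit.
Unset Printing Implicit Defensive.

(** * Directional derivatives *)

Section RealCalculus.
Variables (R : realType) (V : normedModType R).
Implicit Types (f g : V -> R) (p u v : V) (S : set V).

Lemma near_line S p v : open S -> S p -> \forall s \near (0 : R), S (p + s *: v).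
Proof.
move=> oS Sp.
have c : (fun s : R => p + s *: v) @ (0 : R) --> p.
  rewrite -[X in _ --> X]addr0 -[X in _ + X](scale0r v).
  by apply: cvgD; [exact: cvg_cst|apply: cvgZr_tmp; exact: cvg_id].
by apply: c; exact: open_nbhs_nbhs.
Qed.

(** Near 0 the constraint [S (p + s *: v)] always holds, so it leaves the filter unchanged. Asking
    for this only along the line lets the lemma serve the half-line of times at t > 0 as well as
    open sets. *)
Lemma within_quotE S f p v : (\forall s \near (0 : R), S (p + s *: v)) ->
  within_quot S f p v =
  ((fun h => h^-1 *: ((f \o shift p) (h *: v) - f p)) @ (0 : R)^').
Proof.
move=> nS; rewrite /within_quot.
have -> : within [set s : R | S (p + s *: v)] (0 : R)^' = (0 : R)^'.
  rewrite eqEsubset; split => [A|A]; last exact: cvg_within.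
  rewrite /within /= => h.
  have hS : \forall s \near (0 : R)^', S (p + s *: v) by exact: cvg_within nS.
  by apply: filterS2 h hS => s; exact.
have -> // : (fun s : R => s^-1 * (f (p + s *: v) - f p)) =
  (fun h => h^-1 *: ((f \o shift p) (h *: v) - f p)).
by apply/funext => s /=; rewrite [p + _]addrC.
Qed.

Lemma derivable_withinE S f p v : open S -> S p ->
  derivable_within S f p v = derivable f p v.
Proof.
by move=> oS Sp; rewrite /derivable_within within_quotE //; exact: near_line.
Qed.

Lemma derive_withinE S f p v : open S -> S p ->
  derive_within S f p v = 'D_v f p.
Proof. by move=> oS Sp; rewrite /derive_within within_quotE //; exact: near_line. Qed.

Lemma continuous_on_open S f : open S -> {within S, continuous f} ->
  forall p, S p -> {for p, continuous f}.
Proof.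
by move=> oS; rewrite continuous_open_subspace // => cf p Sp; apply: cf; rewrite inE.
Qed.

(* Unlike [Ck_on 1], this is insensitive to the values of f outside S *)
Definition C1 S f := forall v p, S p ->
  derivable f p v /\ {for p, continuous ('D_v f)}.

Definition C2 S f := C1 S f /\ forall v, C1 S ('D_v f).


Lemma near_open S p (P : V -> Prop) : open S -> S p -> (forall q, S q -> P q) ->
  \forall q \near p, P q.
Proof. by move=> oS Sp SP; apply: filterS SP _; exact: open_nbhs_nbhs. Qed.

(** Derivability, the value of ['D_v f] and its continuity at a point depend only on the function
    near that point. *)
Lemma eq_C1 S f g : open S -> (forall p, S p -> f p = g p) -> C1 S f -> C1 S g.
Proof.
move=> oS fg Cf v p Sp; have [df cf] := Cf v p Sp; split.
  by apply: near_eq_derivable df; exact: near_open fg.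
apply: cvg_trans (_ : 'D_v f @ p --> _).
  apply: near_eq_cvg; apply: near_open (oS) Sp _ => q Sq.
  by apply: near_eq_derive; exact: near_open fg.
suff <- : 'D_v f p = 'D_v g p by [].
by apply: near_eq_derive; exact: near_open fg.
Qed.

Lemma C1_Ck_on S f : open S -> Ck_on 1 S f -> C1 S f.
Proof.
move=> oS /= [_ df] v p Sp; have [dfv [cfv _]] := df v; split.
  by have := dfv p Sp; rewrite derivable_withinE.
have := continuous_on_open oS cfv Sp.
rewrite /prop_for /continuous_at -(derive_withinE f v oS Sp); apply: cvg_trans.
apply: near_eq_cvg; apply: near_open (oS) Sp _ => q Sq.
by rewrite derive_withinE.
Qed.

(** [derive_within] and ['D_v] are only known to agree on S, so the second-order part is transferred
    by [eq_C1]. *)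
Lemma C2_smooth_on S f : open S -> smooth_on S f -> C2 S f.
Proof.
move=> oS /(_ 2%N) [cf df]; split.
  apply: C1_Ck_on => //; split => // v; have [? [? ?]] := df v.
  by split.
move=> v; have [dfv Cfv] := df v.
apply: (@eq_C1 _ (fun p => derive_within S f p v)) => //.
  by move=> p Sp; rewrite derive_withinE.
exact: C1_Ck_on.
Qed.

Lemma is_derive_line f p v (s : R) : derivable f (p + s *: v) v ->
  is_derive s 1 (fun t => f (p + t *: v)) ('D_v f (p + s *: v)).
Proof.
have E : (fun h : R => h^-1 *: (((fun t => f (p + t *: v)) \o shift s) (h *: 1) -
    f (p + s *: v))) =
    (fun h => h^-1 *: ((f \o shift (p + s *: v)) (h *: v) - f (p + s *: v))).
  apply/funext => h /=; congr (_ *: (f _ - _)).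
  by rewrite [h%:A]mulr1 scalerDl addrCA.
by move=> df; split; rewrite /derivable /derive /= E.
Qed.

End RealCalculus.

(** * Mean value arguments: linearity in the direction and the second derivative at a minimum *)

Section MeanValue.
Variables (R : realType) (V : normedModType R).
Implicit Types (f g : V -> R) (p q u v : V) (S : set V).

(** The mean value theorem on [0, s] or [s, 0]; both signs of [s] occur because the lemma is used
    inside a two-sided limit. *)
Lemma MVT_line f q v (s : R) :
  (forall t : R, `|t| <= `|s| -> derivable f (q + t *: v) v) ->
  exists2 t : R, `|t| <= `|s| & f (q + s *: v) - f q = s * 'D_v f (q + t *: v).
Proof.
move=> df.
have main (a b : R) : a <= b ->
    (forall t, t \in `[a, b] -> derivable f (q + t *: v) v) ->
    exists2 t, t \in `[a, b] & f (q + b *: v) - f (q + a *: v) =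
      'D_v f (q + t *: v) * (b - a).
  move=> ab dab.
  apply: (@MVT_segment _ (fun t => f (q + t *: v)) (fun t => 'D_v f (q + t *: v))).
  - exact: ab.
  - move=> t tab; apply: is_derive_line; apply: dab.
    by move: tab; apply: subset_itvW.
  - apply: derivable_within_continuous => t tab.
    by have [] := is_derive_line (dab _ tab).
have [s0|s0] := leP 0 s.
  have [|t] := main 0 s s0.
    move=> t; rewrite in_itv /= => /andP[t0 ts]; apply: df.
    by rewrite !ger0_norm.
  rewrite in_itv /= => /andP[t0 ts]; rewrite scale0r addr0 subr0 mulrC => E.
  by exists t => //; rewrite !ger0_norm.
have [|t] := main s 0 (ltW s0).
  move=> t; rewrite in_itv /= => /andP[st t0]; apply: df.
  by rewrite (ler0_norm t0) (ltr0_norm s0) lerN2.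
rewrite in_itv /= => /andP[st t0]; rewrite scale0r addr0 sub0r => E.
exists t; first by rewrite (ler0_norm t0) (ltr0_norm s0) lerN2.
by rewrite -opprB E mulrN opprK mulrC.
Qed.

(** The increment is split into a step along u followed by a step along v. By the mean value theorem
    the second step contributes ['D_v f] at an intermediate point, which tends to ['D_v f p] by
    continuity. *)
Lemma deriveDdir S f p u v : open S -> C1 S f -> S p ->
  'D_(u + v) f p = 'D_u f p + 'D_v f p.
Proof.
move=> oS Cf Sp; apply/cvg_lim => //.
apply/cvgrPdist_le => e e0.
have e20 : 0 < e / 2 by rewrite divr_gt0.
have [du _] := Cf u p Sp; have [_ cv] := Cf v p Sp.
have near_u : \forall s \near (0 : R)^',
    `|'D_u f p - s^-1 *: (f (s *: u + p) - f p)| <= e / 2.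
  by move/cvgrPdist_le : du; exact.
(* Neighbourhoods of 0 for the two parameters in which p + a u + b v stays in S and ['D_v f] is
   within e / 2 of its value at p. *)
have [A [A0 [B [B0 AB]]]] : exists A : set R, nbhs (0 : R) A /\
    exists B : set R, nbhs (0 : R) B /\ forall a b, A a -> B b ->
    S (p + a *: u + b *: v) /\
    `|'D_v f p - 'D_v f (p + a *: u + b *: v)| <= e / 2.
  have c : (fun ab : R * R => p + ab.1 *: u + ab.2 *: v) @ ((0 : R), (0 : R)) --> p.
    rewrite -[X in _ --> X]addr0 -[X in _ --> _ + X](scale0r v).
    apply: cvgD; last by apply: cvgZr_tmp; exact: cvg_snd.
    rewrite -[X in _ --> X]addr0 -[X in _ --> _ + X](scale0r u).
    apply: cvgD; first exact: cvg_cst.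
    by apply: cvgZr_tmp; exact: cvg_fst.
  have : \forall q \near p, S q /\ `|'D_v f p - 'D_v f q| <= e / 2.
    apply: filterI; first exact: open_nbhs_nbhs.
    by move/cvgrPdist_le : cv; exact.
  move=> /c [[A B] [/= A0 B0] AB]; exists A; split => //; exists B; split => // a b Aa Bb.
  by have := AB (a, b) (conj Aa Bb).
move: B0 => /nbhs_ballP[d /= d0 dB].
have A0' : \forall s \near (0 : R)^', A s by exact: cvg_within A0.
near=> s.
have s0 : s != 0 by near: s; exact: nbhs_dnbhs_neq.
have sd : `|s| < d by near: s; exact: dnbhs0_lt.
have As : A s by near: s; exact: A0'.
have BS (t : R) : `|t| <= `|s| -> B t.
  by move=> ts; apply: dB; rewrite /ball /= sub0r normrN (le_lt_trans ts).
have dv (t : R) : `|t| <= `|s| -> derivable f (p + s *: u + t *: v) v.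
  by move=> ts; have [Spt _] := AB s t As (BS t ts); have [] := Cf v _ Spt.
have [t ts E] := MVT_line dv.
have [_ dvt] := AB s t As (BS t ts).
have -> : s^-1 *: ((f \o shift p) (s *: (u + v)) - f p) =
    s^-1 *: (f (s *: u + p) - f p) + 'D_v f (p + s *: u + t *: v).
  rewrite /= (_ : s *: (u + v) + p = p + s *: u + s *: v); last first.
    by rewrite scalerDr addrC addrA.
  have -> : f (p + s *: u + s *: v) - f p =
      (f (s *: u + p) - f p) + s * 'D_v f (p + s *: u + t *: v).
    by rewrite -E [s *: u + p]addrC [RHS]addrC addrA subrK.
  by rewrite scalerDr; congr (_ + _); rewrite /GRing.scale /= mulKf.
rewrite opprD addrACA (splitr e); apply: le_trans (ler_normD _ _) _.
apply: lerD => //.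
by near: s.
Unshelve. all: by end_near. Qed.

(** For nonzero c the substitution s -> s c preserves the limit along punctured neighbourhoods of
    0. *)
Lemma deriveZdir f p v (c : R) : derivable f p v ->
  derivable f p (c *: v) /\ 'D_(c *: v) f p = c * 'D_v f p.
Proof.
move=> df; have [->|c0] := eqVneq c 0.
  by rewrite scale0r mul0r derive0; split; [exact: derivable0|].
have h : (fun s => s^-1 *: ((f \o shift p) (s *: (c *: v)) - f p)) @ (0 : R)^' -->
    c * 'D_v f p.
  have -> : (fun s => s^-1 *: ((f \o shift p) (s *: (c *: v)) - f p)) =
      (fun s => c * ((s * c)^-1 *: ((f \o shift p) ((s * c) *: v) - f p))).
    apply/funext => s /=; rewrite scalerA -[RHS]/(c *: _) scalerA.
    by rewrite invfM mulrCA mulfV // mulr1.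
  apply: cvgM; first exact: cvg_cst.
  apply: cvg_comp df => A /=.
  move=> /nbhs_ballP[e /= e0 eA].
  apply/nbhs_ballP; exists (e / `|c|) => /=.
    by rewrite divr_gt0 // normr_gt0.
  move=> s; rewrite /ball /= sub0r normrN ltr_pdivlMr ?normr_gt0 // => sc s0.
  apply: eA; last by rewrite mulf_neq0.
  by rewrite /ball /= sub0r normrN normrM.
by split; [apply/cvg_ex; exists (c * 'D_v f p)|exact/cvg_lim].
Qed.

(** The first derivative vanishes at the minimum. If the second were negative, the first would be
    negative just to the right of 0, and the mean value theorem would give a value below the
    minimum. *)
Lemma deriv2_ge0_at_min (phi : R -> R) (e : R) : 0 < e ->
  (forall s, `|s| < e -> derivable phi s 1) ->
  derivable ('D_1 phi) 0 1 -> (forall s, `|s| < e -> phi 0 <= phi s) ->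
  0 <= 'D_1 ('D_1 phi) 0.
Proof.
move=> e0 dphi d2phi phi_min.
have eitv (s : R) : (s \in `]- e, e[) = (`|s| < e) by rewrite in_itv /= ltr_norml.
have d0 : 'D_1 phi 0 = 0.
  suff [_ ->] : is_derive (0 : R) (1 : R) phi 0 by [].
  apply: (@derive1_at_min _ _ (- e) e).
  - by rewrite ge0_cp // ltW.
  - by move=> t; rewrite eitv; exact: dphi.
  - by rewrite eitv normr0.
  - by move=> t; rewrite eitv; exact: phi_min.
rewrite leNgt; apply/negP => d2neg.
have : \forall s \near (0 : R)^', s^-1 *: ('D_1 phi (s *: 1 + 0) - 'D_1 phi 0) < 0.
  by apply: cvgr_lt d2neg; exact: d2phi.
move=> /nbhs_ballP[d /= d_gt0 dneg].
pose s := Num.min d e / 2.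
have m0 : 0 < Num.min d e by rewrite lt_min d_gt0.
have s0 : 0 < s by rewrite divr_gt0.
have sm : s < Num.min d e by rewrite ltr_pdivrMr // ltr_pMr // ltr1n.
have [sd se] : s < d /\ s < e by move: sm; rewrite lt_min => /andP.
have dI (t : R) : t \in `[0, s] -> derivable phi t 1.
  rewrite in_itv /= => /andP[t0 ts]; apply: dphi.
  by rewrite ger0_norm // (le_lt_trans ts).
have [t] : exists2 c, c \in `]0, s[ & phi s - phi 0 = 'D_1 phi c * (s - 0).
  apply: (@MVT R phi ('D_1 phi) 0 s s0).
    move=> t ts; apply: DeriveDef; last by [].
    by apply: dI; apply: subset_itvW ts.
  by apply: derivable_within_continuous.
rewrite in_itv /= subr0 => /andP[t0 ts] E.
have := dneg t; rewrite /ball /= sub0r normrN gtr0_norm // => /(_ (lt_trans ts sd)).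
move=> /(_ (lt0r_neq0 t0)); rewrite d0 subr0 addr0 [t%:A]mulr1.
rewrite pmulr_rlt0 ?invr_gt0 // => dt.
have := phi_min s; rewrite gtr0_norm // => /(_ se).
by rewrite -subr_ge0 E pmulr_lge0 // leNgt dt.
Qed.

End MeanValue.

(** * Second-order test for a quadratic polynomial with varying coefficients *)

Section Parabola.
Variable R : realType.

(** The function a + s b + s^2 c has a minimum with value 0 at s = 0, and its second derivative
    there is the number in the conclusion. *)
Lemma parabola_test1 (a a' b b' c c' : R -> R) (a2 b2 c2 e : R) : 0 < e ->
  (forall s, `|s| < e -> [/\ is_derive (s : R) (1 : R) a (a' s), is_derive (s : R) (1 : R) b (b' s) &
    is_derive (s : R) (1 : R) c (c' s)]) ->
  is_derive (0 : R) (1 : R) a' a2 -> is_derive (0 : R) (1 : R) b' b2 -> is_derive (0 : R) (1 : R) c' c2 ->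
  a 0 = 0 -> (forall s, `|s| < e -> 0 <= a s + s * b s + s ^+ 2 * c s) ->
  0 <= a2 + 2 * b' 0 + 2 * c 0.
Proof.
move=> e0 dabc da2 db2 dc2 a0 abc.
pose phi : R -> R := a + id * (b + id * c).
(* The derivative of [phi], expanded into summands [id * _] so that [isM] can differentiate it once
   more. *)
pose psi : R -> R := a' + (b + id * b' + (id * c + (id * c + id * (id * c')))).
have isM (s : R) (g : R -> R) (dg : R) : is_derive s (1 : R) g dg ->
    is_derive s (1 : R) (id * g) (g s + s * dg).
  move=> dg1; have := is_deriveM (is_derive_id s (1 : R)) dg1.
  by rewrite /GRing.scale /= mulr1 addrC.
have dphi s : `|s| < e -> is_derive s (1 : R) phi (psi s).
  move=> /dabc[da db dc].
  have := is_deriveD da (isM _ _ _ (is_deriveD db (isM _ _ _ dc))).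
  suff <- : a' s + ((b + id * c) s + s * (b' s + (c s + s * c' s))) = psi s by [].
  rewrite /psi !fctE; ring.
have dpsi : is_derive (0 : R) (1 : R) psi (a2 + 2 * b' 0 + 2 * c 0).
  have [_ db dc] : [/\ is_derive (0 : R) (1 : R) a (a' 0),
    is_derive (0 : R) (1 : R) b (b' 0) &
    is_derive (0 : R) (1 : R) c (c' 0)] by apply: dabc; rewrite normr0.
  have dsc := isM _ _ _ dc.
  have := is_deriveD da2 (is_deriveD (is_deriveD db (isM _ _ _ db2))
    (is_deriveD dsc (is_deriveD dsc (isM _ _ _ (isM _ _ _ dc2))))).
  suff -> : a2 + 2 * b' 0 + 2 * c 0 = a2 + (b' 0 + (b' 0 + 0 * b2) +
    (c 0 + 0 * c' 0 + (c 0 + 0 * c' 0 + ((id * c') 0 + 0 * (c' 0 + 0 * c2))))) by [].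
  rewrite !fctE; ring.
have E : \forall s \near (0 : R), psi s = 'D_1 phi s.
  have : \forall s \near (0 : R), `|s| < e by exact: nbhs0_lt.
  by apply: filterS => s /dphi [_ ->].
have [dD <-] := near_eq_is_derive E dpsi.
apply: (deriv2_ge0_at_min e0 _ dD).
  by move=> s /dphi[].
move=> s /abc; rewrite /phi !fctE /= a0 mul0r addr0.
by rewrite mulrDr addrA mulrA expr2.
Qed.

(** The one-variable test on the line through p. Later A, B and C are the coefficients in s of a
    form D evaluated at the moving vector v + s w, where D also varies with the point. *)
Lemma parabola_test (V : normedModType R) (S : set V) (A B C : V -> R) (p xi : V) :
  open S -> S p -> C2 S A -> C2 S B -> C2 S C -> A p = 0 ->
  (forall s : R, S (p + s *: xi) ->
     0 <= A (p + s *: xi) + s * B (p + s *: xi) + s ^+ 2 * C (p + s *: xi)) ->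
  0 <= 'D_xi ('D_xi A) p + 2 * 'D_xi B p + 2 * C p.
Proof.
move=> oS Sp C2A C2B C2C A0 pos.
have /nbhs_ballP[e /= e0 eS] := near_line xi oS Sp.
have eS' s : `|s| < e -> S (p + s *: xi).
  by move=> se; apply: eS; rewrite /ball /= sub0r normrN.
have p0 : p = p + (0 : R) *: xi by rewrite scale0r addr0.
have d1 F s : C2 S F -> `|s| < e ->
    is_derive (s : R) (1 : R) (fun t => F (p + t *: xi)) ('D_xi F (p + s *: xi)).
  by move=> [CF _] se; apply: is_derive_line; have [] := CF xi _ (eS' s se).
have d2 F : C2 S F ->
    is_derive (0 : R) (1 : R) (fun t => 'D_xi F (p + t *: xi)) ('D_xi ('D_xi F) p).
  move=> [_ CF]; rewrite {2}p0; apply: is_derive_line; rewrite -p0.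
  by have [] := CF xi xi p Sp.
rewrite [in 'D_xi B _]p0 [in C _]p0.
apply: (@parabola_test1 (fun s => A (p + s *: xi)) (fun s => 'D_xi A (p + s *: xi))
  (fun s => B (p + s *: xi)) (fun s => 'D_xi B (p + s *: xi))
  (fun s => C (p + s *: xi)) (fun s => 'D_xi C (p + s *: xi)) _ _ _ e e0 _
  (d2 _ C2A) (d2 _ C2B) (d2 _ C2C)).
- by move=> s se; split; exact: d1.
- by rewrite -p0.
- by move=> s se; apply: pos; exact: eS'.
Qed.

End Parabola.

(** * Linear combinations of C^1 and C^2 functions *)

Section C2Closure.
Variables (R : realType) (V : normedModType R) (S : set V).
Implicit Types (f g : V -> R).
Hypothesis oS : open S.

Lemma C1D f g : C1 S f -> C1 S g -> C1 S (f + g).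
Proof.
move=> Cf Cg v p Sp; have [df cf] := Cf v p Sp; have [dg cg] := Cg v p Sp.
split; first exact: derivableD.
have : (fun q => 'D_v f q + 'D_v g q) @ p --> 'D_v f p + 'D_v g p.
  by apply: cvgD; [exact: cf|exact: cg].
rewrite /prop_for /continuous_at (deriveD df dg); apply: cvg_trans.
apply: near_eq_cvg; apply: near_open (oS) Sp _ => q Sq /=.
by have [? _] := Cf v q Sq; have [? _] := Cg v q Sq; rewrite deriveD.
Qed.

Lemma C1Z (c : R) f : C1 S f -> C1 S (c *: f).
Proof.
move=> Cf v p Sp; have [df cf] := Cf v p Sp.
split; first exact: derivableZ.
have : (fun q => c * 'D_v f q) @ p --> c * 'D_v f p.
  by apply: cvgM; [exact: cvg_cst|exact: cf].
rewrite /prop_for /continuous_at (deriveZ c df); apply: cvg_trans.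
apply: near_eq_cvg; apply: near_open (oS) Sp _ => q Sq /=.
by have [? _] := Cf v q Sq; rewrite deriveZ.
Qed.

Lemma C2D f g : C2 S f -> C2 S g -> C2 S (f + g).
Proof.
move=> [Cf C2f] [Cg C2g]; split; first exact: C1D.
move=> v; apply: eq_C1 (C1D (C2f v) (C2g v)) => // p Sp.
by have [? _] := Cf v p Sp; have [? _] := Cg v p Sp; rewrite deriveD.
Qed.

Lemma C2Z (c : R) f : C2 S f -> C2 S (c *: f).
Proof.
move=> [Cf C2f]; split; first exact: C1Z.
move=> v; apply: eq_C1 (C1Z c (C2f v)) => // p Sp.
by have [? _] := Cf v p Sp; rewrite deriveZ.
Qed.

End C2Closure.

(** * Complex-valued functions *)

Section ComplexArith.
Variable R : rcfType.
Implicit Types x y : R[i].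

Lemma complex_ReD x y : complex.Re (x + y) = complex.Re x + complex.Re y.
Proof. by case: x; case: y. Qed.
Lemma complex_ImD x y : complex.Im (x + y) = complex.Im x + complex.Im y.
Proof. by case: x; case: y. Qed.
Lemma complex_ReN x : complex.Re (- x) = - complex.Re x.
Proof. by case: x. Qed.
Lemma complex_ImN x : complex.Im (- x) = - complex.Im x.
Proof. by case: x. Qed.
Lemma complex_ReM x y : complex.Re (x * y) =
  complex.Re x * complex.Re y - complex.Im x * complex.Im y.
Proof. by case: x; case: y. Qed.
Lemma complex_ImM x y : complex.Im (x * y) =
  complex.Re x * complex.Im y + complex.Im x * complex.Re y.
Proof. by case: x; case: y. Qed.
Lemma complex_Re_conj x : complex.Re (Num.conj x) = complex.Re x.
Proof. by case: x. Qed.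
Lemma complex_Im_conj x : complex.Im (Num.conj x) = - complex.Im x.
Proof. by case: x. Qed.
Lemma complex_Re_i : complex.Re ('i : R[i]) = 0.
Proof. by rewrite -complexiE. Qed.
Lemma complex_Im_i : complex.Im ('i : R[i]) = 1.
Proof. by rewrite -complexiE. Qed.
Lemma complex_ext x y : complex.Re x = complex.Re y ->
  complex.Im x = complex.Im y -> x = y.
Proof. by case: x; case: y => /= a b c d -> ->. Qed.

Definition complex_simpE := (complex_ReD, complex_ImD, complex_ReN, complex_ImN,
  complex_ReM, complex_ImM, complex_Re_conj, complex_Im_conj, complex_Re_i,
  complex_Im_i).

Lemma complex_conj_iM x : Num.conj ('i * x) = - 'i * Num.conj x.
Proof. by apply: complex_ext; rewrite !complex_simpE; ring. Qed.

Lemma complex_conj_iNM x : Num.conj (- 'i * x) = 'i * Num.conj x.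
Proof. by apply: complex_ext; rewrite !complex_simpE; ring. Qed.

Lemma complex_sqr_i : 'i * 'i = -1 :> R[i].
Proof. by rewrite -expr2 sqrCi. Qed.

Lemma complex_inv2 : 2^-1 = (2^-1)%:C%C :> R[i].
Proof. by rewrite fmorphV rmorph_nat. Qed.

Lemma complex_Re_sum (I : Type) (r : seq I) (P : pred I) (F : I -> R[i]) :
  complex.Re (\sum_(i <- r | P i) F i) = \sum_(i <- r | P i) complex.Re (F i).
Proof. by apply: (big_morph _ complex_ReD). Qed.

End ComplexArith.

(** * Differentiation rules for complex-valued functions *)

Section ComplexDerivative.
Variables (R : realType) (V : normedModType R).
Implicit Types (F G : V -> R[i]) (v p : V) (d : R[i]).

(** The direction is a vector of an arbitrary real normed space, so that the same rules serve the
    directions of C^n and the time variable. *)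
Definition is_cderive v F p d :=
  is_derive p v (fun q => complex.Re (F q)) (complex.Re d) /\
  is_derive p v (fun q => complex.Im (F q)) (complex.Im d).

Lemma is_cderive_near v F G p d : (\forall q \near p, F q = G q) ->
  is_cderive v F p d -> is_cderive v G p d.
Proof.
by move=> FG [dr di]; split; [apply: near_eq_is_derive dr|apply: near_eq_is_derive di];
  apply: filterS FG => q ->.
Qed.

Lemma is_cderive_cst v (c : R[i]) p : is_cderive v (fun=> c) p 0.
Proof. by split; exact: is_derive_cst. Qed.

Lemma is_cderiveD v F G p d e : is_cderive v F p d -> is_cderive v G p e ->
  is_cderive v (fun q => F q + G q) p (d + e).
Proof.
move=> [dFr dFi] [dGr dGi]; rewrite /is_cderive !complex_simpE; split.
  have := is_deriveD dFr dGr.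
  by congr is_derive; apply/funext => q; rewrite complex_ReD.
have := is_deriveD dFi dGi.
by congr is_derive; apply/funext => q; rewrite complex_ImD.
Qed.

Lemma is_cderiveM v F G p d e : is_cderive v F p d -> is_cderive v G p e ->
  is_cderive v (fun q => F q * G q) p (d * G p + F p * e).
Proof.
move=> [dFr dFi] [dGr dGi]; rewrite /is_cderive !complex_simpE; split.
  have := is_deriveB (is_deriveM dFr dGr) (is_deriveM dFi dGi).
  congr is_derive; first by apply/funext => q; rewrite complex_ReM.
  by rewrite /GRing.scale /=; ring.
have := is_deriveD (is_deriveM dFr dGi) (is_deriveM dFi dGr).
congr is_derive; first by apply/funext => q; rewrite complex_ImM.
by rewrite /GRing.scale /=; ring.
Qed.

Lemma is_cderiveZ v F p d (c : R[i]) : is_cderive v F p d ->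
  is_cderive v (fun q => c * F q) p (c * d).
Proof.
by move=> dF; have := is_cderiveM (is_cderive_cst v c p) dF; rewrite mul0r add0r.
Qed.

Lemma is_cderive_sum v (I : Type) (r : seq I) (P : pred I)
    (F : I -> V -> R[i]) p (d : I -> R[i]) :
  (forall i, P i -> is_cderive v (F i) p (d i)) ->
  is_cderive v (fun q => \sum_(i <- r | P i) F i q) p (\sum_(i <- r | P i) d i).
Proof.
move=> dF; elim: r => [|i r IH].
  have := is_cderive_cst v 0 p; rewrite big_nil.
  by congr is_cderive; apply/funext => q; rewrite big_nil.
rewrite big_cons; under [X in is_cderive _ X]eq_fun do rewrite big_cons.
by case: ifP => // Pi; apply: is_cderiveD => //; exact: dF.
Qed.

End ComplexDerivative.

Section ComplexDerivable.
Variables (R : realType) (n : nat).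
Implicit Types (F G : cspace R n -> R[i]) (v p : cspace R n) (d : R[i]).

Definition cderivable v F p := is_cderive v F p (cderive v F p).

Lemma is_cderiveE v F p d : is_cderive v F p d -> cderive v F p = d.
Proof. by rewrite /cderive => -[[_ ->] [_ ->]]; case: d. Qed.

Lemma is_cderive_ex v F p d : is_cderive v F p d -> cderivable v F p.
Proof. by move=> dF; rewrite /cderivable (is_cderiveE dF). Qed.

Lemma cderivable_sum v (I : Type) (r : seq I) (P : pred I)
    (F : I -> cspace R n -> R[i]) p :
  (forall i, P i -> cderivable v (F i) p) ->
  cderivable v (fun q => \sum_(i <- r | P i) F i q) p.
Proof. by move=> dF; apply: is_cderive_ex (is_cderive_sum _ dF). Qed.

Lemma cderivableM v F G p : cderivable v F p -> cderivable v G p ->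
  cderivable v (fun q => F q * G q) p.
Proof. by move=> dF dG; apply: is_cderive_ex (is_cderiveM dF dG). Qed.

Lemma cderivableZ v F p (c : R[i]) : cderivable v F p ->
  cderivable v (fun q => c * F q) p.
Proof. by move=> dF; apply: is_cderive_ex (is_cderiveZ c dF). Qed.

Lemma cderivable_prod v (I : Type) (r : seq I) (F : I -> cspace R n -> R[i]) p :
  (forall i, cderivable v (F i) p) ->
  cderivable v (fun q => \prod_(i <- r) F i q) p.
Proof.
move=> dF; elim: r => [|i r IH].
  under [X in cderivable _ X]eq_fun do rewrite big_nil.
  exact: is_cderive_ex (is_cderive_cst v 1 p).
under [X in cderivable _ X]eq_fun do rewrite big_cons.
exact: is_cderive_ex (is_cderiveM (dF i) IH).
Qed.

(** 1 / F is the conjugate of F divided by N = |F|^2. *)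
Lemma cderivableV v F p : F p != 0 -> cderivable v F p ->
  cderivable v (fun q => (F q)^-1) p.
Proof.
move=> F0 [dr di].
pose N q := complex.Re (F q) * complex.Re (F q) + complex.Im (F q) * complex.Im (F q).
have N0 : N p != 0.
  rewrite /N -!expr2 paddr_eq0 ?sqr_ge0 // !sqrf_eq0; apply: contra F0.
  by case: (F p) => a b /= /andP[/eqP-> /eqP->].
have dN : derivable N p v.
  have [] := is_deriveD (is_deriveM dr dr) (is_deriveM di di); exact.
have [dVr _] : is_derive p v _ _ := derivableP (derivableV N0 dN).
have [dFr _] := dr; have [dFi _] := di.
have VE q : (F q)^-1 = (complex.Re (F q) * (N q)^-1 +i* - (complex.Im (F q) * (N q)^-1))%C.
  by rewrite /N -!expr2; case: (F q).
split; apply: derivableP.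
  under eq_fun do rewrite VE /=.
  exact: derivableM dFr dVr.
under eq_fun do rewrite VE /=.
exact: derivableN (derivableM dFi dVr).
Qed.

End ComplexDerivable.

(** * Complex-valued C^1 and C^2 functions, and complex vectors as real directions *)

Section ComplexSmooth.
Variables (R : realType) (n : nat) (S : set (cspace R n)).
Hypothesis oS : open S.
Implicit Types (F G : cspace R n -> R[i]) (u v p : cspace R n) (c : 'rV[R[i]]_n).

Definition cC1 F := C1 S (fun q => complex.Re (F q)) /\ C1 S (fun q => complex.Im (F q)).
Definition cC2 F := C2 S (fun q => complex.Re (F q)) /\ C2 S (fun q => complex.Im (F q)).

Lemma cC2_csmooth_on F : csmooth_on S F -> cC2 F.
Proof. by move=> [Fr Fi]; split; exact: C2_smooth_on. Qed.

Lemma cC2_cC1 F : cC2 F -> cC1 F.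
Proof. by move=> [[? _] [? _]]. Qed.

Lemma cC2_cderive v F : cC2 F -> cC1 (cderive v F).
Proof. by move=> [[_ Fr] [_ Fi]]; split; [exact: Fr|exact: Fi]. Qed.

Lemma cC1_cderivable v F p : cC1 F -> S p -> cderivable v F p.
Proof.
move=> [Fr Fi] Sp; split; apply: derivableP; first by have [] := Fr v p Sp.
by have [] := Fi v p Sp.
Qed.

Lemma cC1D F G : cC1 F -> cC1 G -> cC1 (fun q => F q + G q).
Proof.
move=> [Fr Fi] [Gr Gi]; split.
  have := C1D oS Fr Gr.
  by congr C1; apply/funext => q; rewrite complex_ReD.
have := C1D oS Fi Gi.
by congr C1; apply/funext => q; rewrite complex_ImD.
Qed.

Lemma cC1Z (a : R[i]) F : cC1 F -> cC1 (fun q => a * F q).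
Proof.
move=> [Fr Fi]; split.
  have := C1D oS (C1Z oS (complex.Re a) Fr) (C1Z oS (- complex.Im a) Fi).
  by congr C1; apply/funext => q; rewrite complex_ReM -mulNr.
have := C1D oS (C1Z oS (complex.Re a) Fi) (C1Z oS (complex.Im a) Fr).
by congr C1; apply/funext => q; rewrite complex_ImM.
Qed.

Lemma cC2D F G : cC2 F -> cC2 G -> cC2 (fun q => F q + G q).
Proof.
move=> [Fr Fi] [Gr Gi]; split.
  have := C2D oS Fr Gr.
  by congr C2; apply/funext => q; rewrite complex_ReD.
have := C2D oS Fi Gi.
by congr C2; apply/funext => q; rewrite complex_ImD.
Qed.

Lemma cC2Z (a : R[i]) F : cC2 F -> cC2 (fun q => a * F q).
Proof.
move=> [Fr Fi]; split.
  have := C2D oS (C2Z oS (complex.Re a) Fr) (C2Z oS (- complex.Im a) Fi).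
  by congr C2; apply/funext => q; rewrite complex_ReM -mulNr.
have := C2D oS (C2Z oS (complex.Re a) Fi) (C2Z oS (complex.Im a) Fr).
by congr C2; apply/funext => q; rewrite complex_ImM.
Qed.

Lemma C1_0 : C1 S (fun _ : cspace R n => 0 : R).
Proof.
move=> v p _; split; first exact: derivable_cst.
rewrite (_ : 'D_v _ = fun=> 0); first exact: cst_continuous.
by apply/funext => q; exact: derive_cst.
Qed.

Lemma C2_0 : C2 S (fun _ : cspace R n => 0 : R).
Proof.
split; first exact: C1_0.
move=> v; rewrite (_ : 'D_v _ = fun=> 0); first exact: C1_0.
by apply/funext => q; exact: derive_cst.
Qed.

Lemma cC1_sum (I : Type) (r : seq I) (F : I -> cspace R n -> R[i]) :
  (forall i, cC1 (F i)) -> cC1 (fun q => \sum_(i <- r) F i q).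
Proof.
move=> CF; elim: r => [|i r IH].
  by under eq_fun do rewrite big_nil; split; exact: C1_0.
under eq_fun do rewrite big_cons.
exact: (cC1D (CF i) IH).
Qed.

Lemma cC2_sum (I : Type) (r : seq I) (F : I -> cspace R n -> R[i]) :
  (forall i, cC2 (F i)) -> cC2 (fun q => \sum_(i <- r) F i q).
Proof.
move=> CF; elim: r => [|i r IH].
  by under eq_fun do rewrite big_nil; split; exact: C2_0.
under eq_fun do rewrite big_cons.
exact: (cC2D (CF i) IH).
Qed.

Lemma cC2_dz k F : cC2 F -> cC1 (dz k F).
Proof.
move=> CF; rewrite /dz /dx /dy.
have := cC1Z 2^-1 (cC1D (cC2_cderive (delta_mx 0 k, 0) CF)
  (cC1Z (- 'i) (cC2_cderive (0, delta_mx 0 k) CF))).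
by congr cC1; apply/funext => q; rewrite mulNr.
Qed.

Lemma cderiveDdir u v F p : cC1 F -> S p ->
  cderive (u + v) F p = cderive u F p + cderive v F p.
Proof.
move=> [Fr Fi] Sp; apply: complex_ext; rewrite complex_simpE /=.
  exact: deriveDdir oS Fr Sp.
exact: deriveDdir oS Fi Sp.
Qed.

Lemma cderiveZdir (a : R) v F p : cC1 F -> S p ->
  cderive (a *: v) F p = a%:C%C * cderive v F p.
Proof.
move=> [Fr Fi] Sp; apply: complex_ext; rewrite complex_simpE /= mul0r ?subr0 ?addr0.
  by have [] := deriveZdir a (proj1 (Fr v p Sp)).
by have [] := deriveZdir a (proj1 (Fi v p Sp)).
Qed.

Lemma cderive0dir F p : cderive 0 F p = 0.
Proof. by rewrite /cderive !derive0. Qed.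

Lemma cderive_sum_dir (I : Type) (r : seq I) (v : I -> cspace R n) F p :
  cC1 F -> S p ->
  cderive (\sum_(i <- r) v i) F p = \sum_(i <- r) cderive (v i) F p.
Proof.
move=> CF Sp; elim: r => [|i r IH]; first by rewrite !big_nil cderive0dir.
by rewrite !big_cons cderiveDdir // IH.
Qed.

(** The complex vector c as a real direction; [cvec ('i *: c)] is its image under the complex
    structure. *)
Definition cvec c : cspace R n := (map_mx (@complex.Re R) c, map_mx (@complex.Im R) c).

Lemma cvecE c : cvec c = \sum_j (complex.Re (c 0 j) *: (delta_mx 0 j, 0) +
  complex.Im (c 0 j) *: (0, delta_mx 0 j)).
Proof.
have sumE (f : 'I_n -> cspace R n) : \sum_j f j = (\sum_j (f j).1, \sum_j (f j).2).
  by elim/big_rec3: _ => // j a b [x y] _ [-> ->].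
rewrite sumE /cvec; congr pair.
  rewrite [LHS]row_sum_delta; apply: eq_bigr => j _ /=.
  by rewrite mxE scaler0 addr0.
rewrite [LHS]row_sum_delta; apply: eq_bigr => j _ /=.
by rewrite mxE scaler0 add0r.
Qed.

(** The splitting of the differential into its complex-linear and conjugate-linear parts. *)
Lemma cderive_cvec c F p : cC1 F -> S p ->
  cderive (cvec c) F p =
  \sum_j (c 0 j * dz j F p + Num.conj (c 0 j) * dzbar j F p).
Proof.
move=> CF Sp; rewrite cvecE cderive_sum_dir //; apply: eq_bigr => j _.
rewrite cderiveDdir // !cderiveZdir // /dz /dzbar /dx /dy.
set a := cderive _ _ _; set b := cderive _ _ _.
rewrite -complexiE; case: (c 0 j) => x y.
rewrite complex_inv2.
case: a => a1 a2; case: b => b1 b2; apply: complex_ext => /=; field; by [].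
Qed.

End ComplexSmooth.

(** Algebraic core of 4 dbar d = D_u D_u + D_w D_w for w = i u: the mixed derivatives d and e are
    real, so they contribute only to the imaginary part. *)
Lemma Re_wirtinger (R : rcfType) (a b d e : R[i]) :
  complex.Im d = 0 -> complex.Im e = 0 ->
  4 * complex.Re (2^-1 * (2^-1 * (a - 'i * d) + 'i * (2^-1 * (e - 'i * b)))) =
  complex.Re a + complex.Re b.
Proof.
rewrite -complexiE complex_inv2; move: a b d e => [a a'] [b b'] [d d'] [e e'] /= -> ->.
by field.
Qed.

(** * Wirtinger derivatives along a complex direction and the Levi form *)

Section LeviForm.
Variables (R : realType) (n : nat) (S : set (cspace R n)).
Hypothesis oS : open S.
Implicit Types (F G : cspace R n -> R[i]) (u v p : cspace R n) (c : 'rV[R[i]]_n).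

(** In D_c - i D_(i c) the conjugate-linear parts cancel and the complex-linear parts double; the
    opposite sign in [sum_dzbar] exchanges the roles. *)
Lemma sum_dz c F p : cC1 S F -> S p ->
  \sum_j c 0 j * dz j F p =
  2^-1 * (cderive (cvec c) F p - 'i * cderive (cvec ('i *: c)) F p).
Proof.
move=> CF Sp; rewrite !(cderive_cvec oS _ CF Sp).
rewrite mulr_sumr -sumrB mulr_sumr; apply: eq_bigr => j _.
rewrite !mxE complex_conj_iM.
have n2 : (2 : R[i]) != 0 by rewrite pnatr_eq0.
set z := dz j F p; set zb := dzbar j F p; set a := c 0 j.
have -> : 'i * ('i * a * z + - 'i * Num.conj a * zb) =
   ('i * 'i) * (a * z - Num.conj a * zb) by ring.
by rewrite complex_sqr_i; field.
Qed.

Lemma sum_dzbar c F p : cC1 S F -> S p ->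
  \sum_j Num.conj (c 0 j) * dzbar j F p =
  2^-1 * (cderive (cvec c) F p + 'i * cderive (cvec ('i *: c)) F p).
Proof.
move=> CF Sp; rewrite !(cderive_cvec oS _ CF Sp).
rewrite mulr_sumr -big_split mulr_sumr; apply: eq_bigr => j _ /=.
rewrite !mxE complex_conj_iM.
have n2 : (2 : R[i]) != 0 by rewrite pnatr_eq0.
set z := dz j F p; set zb := dzbar j F p; set a := c 0 j.
have -> : 'i * ('i * a * z + - 'i * Num.conj a * zb) =
   ('i * 'i) * (a * z - Num.conj a * zb) by ring.
by rewrite complex_sqr_i; field.
Qed.

Lemma dzbar_sum (I : Type) (r : seq I) (a : I -> R[i]) (F : I -> cspace R n -> R[i]) k p :
  (forall i, cC1 S (F i)) -> S p ->
  dzbar k (fun q => \sum_(i <- r) a i * F i q) p = \sum_(i <- r) a i * dzbar k (F i) p.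
Proof.
move=> CF Sp; rewrite /dzbar /dx /dy.
have E v : cderive v (fun q => \sum_(i <- r) a i * F i q) p =
    \sum_(i <- r) a i * cderive v (F i) p.
  apply: is_cderiveE; apply: is_cderive_sum => i _; apply: is_cderiveZ.
  exact: cC1_cderivable.
rewrite !E mulr_sumr -big_split mulr_sumr; apply: eq_bigr => i _ /=.
by move: (cderive _ _ _) (cderive _ _ _) => x y; ring.
Qed.

Lemma dz_sum (I : Type) (r : seq I) (a : I -> R[i]) (F : I -> cspace R n -> R[i]) k p :
  (forall i, cC1 S (F i)) -> S p ->
  dz k (fun q => \sum_(i <- r) a i * F i q) p = \sum_(i <- r) a i * dz k (F i) p.
Proof.
move=> CF Sp; rewrite /dz /dx /dy.
have E v : cderive v (fun q => \sum_(i <- r) a i * F i q) p =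
    \sum_(i <- r) a i * cderive v (F i) p.
  apply: is_cderiveE; apply: is_cderive_sum => i _; apply: is_cderiveZ.
  exact: cC1_cderivable.
rewrite !E mulr_sumr -sumrB mulr_sumr; apply: eq_bigr => i _ /=.
by move: (cderive _ _ _) (cderive _ _ _) => x y; ring.
Qed.

Lemma cderive_near v F G p : (\forall q \near p, F q = G q) ->
  cderive v F p = cderive v G p.
Proof.
move=> FG; rewrite /cderive; congr Complex.
  by apply: near_eq_derive; apply: filterS FG => q ->.
by apply: near_eq_derive; apply: filterS FG => q ->.
Qed.

(* A real-valued function has real second derivatives, so the symmetry of mixed
   partial derivatives is not needed. *)
Lemma levi_real c F p : cC2 S F -> S p -> (forall q, S q -> complex.Im (F q) = 0) ->
  4 * complex.Re (\sum_k \sum_j c 0 j * Num.conj (c 0 k) * dzbar k (dz j F) p) =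
  'D_(cvec c) ('D_(cvec c) (fun q => complex.Re (F q))) p +
  'D_(cvec ('i *: c)) ('D_(cvec ('i *: c)) (fun q => complex.Re (F q))) p.
Proof.
move=> CF Sp F0; pose Gc q := \sum_j c 0 j * dz j F q.
have CG : cC1 S Gc.
  by apply: (cC1_sum oS) => j; apply: (cC1Z oS); apply: (cC2_dz oS).
have -> : \sum_k \sum_j c 0 j * Num.conj (c 0 k) * dzbar k (dz j F) p =
    \sum_k Num.conj (c 0 k) * dzbar k Gc p.
  apply: eq_bigr => k _; rewrite (dzbar_sum _ _ _ (fun j => cC2_dz oS j CF) Sp).
  by rewrite mulr_sumr; apply: eq_bigr => j _; rewrite [RHS]mulrCA mulrA.
rewrite (sum_dzbar _ CG Sp).
set u := cvec c; set w := cvec _.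
(* By [sum_dz], valid on S and hence near p, a real derivative of d_c F is expressed by second real
   derivatives of F. *)
have GE v : cderive v Gc p =
    2^-1 * (cderive v (cderive u F) p - 'i * cderive v (cderive w F) p).
  rewrite (@cderive_near _ _ (fun q => 2^-1 * (cderive u F q + (- 'i) * cderive w F q))).
    rewrite -mulNr; apply: is_cderiveE; apply: is_cderiveZ.
    have [CuF CwF] := (cC2_cderive u CF, cC2_cderive w CF).
    by apply: is_cderiveD; [|apply: is_cderiveZ]; apply: (cC1_cderivable _ _ Sp).
  apply: near_open (oS) Sp _ => q Sq; rewrite /Gc (sum_dz _ (cC2_cC1 CF) Sq).
  by rewrite mulNr.
have Im0 v v' : complex.Im (cderive v (cderive v' F) p) = 0.
  rewrite /cderive /=.
  have z : \forall q \near p, 'D_v' (fun q => complex.Im (F q)) q = 0.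
    apply: near_open (oS) Sp _ => q Sq.
    have FG : \forall y \near q, complex.Im (F y) = (fun=> 0) y.
      by apply: near_open (oS) Sq _ => y; exact: F0.
    by rewrite (near_eq_derive _ FG); exact: derive_cst.
  by rewrite (near_eq_derive (g := fun=> 0) _ z); exact: derive_cst.
have ReE v v' : complex.Re (cderive v (cderive v' F) p) =
  'D_v ('D_v' (fun q => complex.Re (F q))) p by [].
by rewrite !GE -!ReE; apply: Re_wirtinger; exact: Im0.
Qed.

End LeviForm.

(** * Second-derivative test for Hermitian forms *)

Section Sesquilinear.
Variables (R : realType) (r : nat).
Implicit Types (M N : 'M[R[i]]_r) (u w : 'cV[R[i]]_r).

Definition sesq M u w : R[i] := \sum_a \sum_b Num.conj (u a 0) * M a b * w b 0.

Lemma sesqE M u w : sesq M u w = ((map_mx Num.conj u)^T *m M *m w) 0 0.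
Proof.
rewrite -mulmxA !mxE; apply: eq_bigr => a _; rewrite !mxE mulr_sumr.
by apply: eq_bigr => b _; rewrite mulrA.
Qed.

Lemma sesqD M N u w : sesq (M + N) u w = sesq M u w + sesq N u w.
Proof. by rewrite !sesqE mulmxDr mulmxDl mxE. Qed.

Lemma sesqB M N u w : sesq (M - N) u w = sesq M u w - sesq N u w.
Proof. by rewrite !sesqE mulmxBr mulmxBl !mxE. Qed.

Lemma sesqZ x M u w : sesq (x *: M) u w = x * sesq M u w.
Proof. by rewrite !sesqE -scalemxAr -scalemxAl mxE. Qed.

Lemma sesq_sum (I : Type) (s : seq I) (M : I -> 'M[R[i]]_r) u w :
  sesq (\sum_(i <- s) M i) u w = \sum_(i <- s) sesq (M i) u w.
Proof.
elim: s => [|i s IH]; last by rewrite !big_cons sesqD IH.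
by rewrite !big_nil sesqE mulmx0 mul0mx mxE.
Qed.

Lemma sesqDl M u u' w : sesq M (u + u') w = sesq M u w + sesq M u' w.
Proof. by rewrite !sesqE map_mxD linearD /= !mulmxDl mxE. Qed.

Lemma sesqDr M u w w' : sesq M u (w + w') = sesq M u w + sesq M u w'.
Proof. by rewrite !sesqE mulmxDr mxE. Qed.

Lemma sesqZl M x u w : sesq M (x *: u) w = Num.conj x * sesq M u w.
Proof. by rewrite !sesqE map_mxZ linearZ /= -!scalemxAl mxE. Qed.

Lemma sesqZr M x u w : sesq M u (x *: w) = x * sesq M u w.
Proof. by rewrite !sesqE -scalemxAr mxE. Qed.

Lemma sesqNr M u w : sesq M u (- w) = - sesq M u w.
Proof. by rewrite -scaleN1r sesqZr mulN1r. Qed.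

Lemma sesq_mulmx M N u w : sesq M u (N *m w) = sesq (M *m N) u w.
Proof. by rewrite !sesqE !mulmxA. Qed.

Lemma sesq_mulmxl M N u w : sesq M (N *m u) w = sesq ((map_mx Num.conj N)^T *m M) u w.
Proof. by rewrite !sesqE map_mxM trmx_mul !mulmxA. Qed.

End Sesquilinear.

(** A quarter of the sum of the two tests. Here X is the Levi form of v^* D v, the g are derivatives
    of s^* D v and the h those of v^* D s along c and i c; they combine into d_c and dbar_c
    derivatives. *)
Lemma directional_algebra (R : realType) (X g1 g2 h1 h2 e : R[i]) (d1 d2 : R) :
  4 * complex.Re X = d1 + d2 ->
  0 <= d1 + 2 * complex.Re (g1 + h1) + 2 * complex.Re e ->
  0 <= d2 + 2 * complex.Re (Num.conj 'i * g2 + 'i * h2) +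
    2 * complex.Re (Num.conj 'i * ('i * e)) ->
  0 <= complex.Re (X + 2^-1 * (g1 - 'i * g2) + 2^-1 * (h1 + 'i * h2) + e).
Proof.
rewrite -complexiE complex_inv2; move: X g1 g2 h1 h2 e.
move=> [X X'] [g1 g1'] [g2 g2'] [h1 h1'] [h2 h2'] [e e'] /=; lra.
Qed.

(** * The test for a nonnegative Hermitian form along a complex direction *)

Section DirectionalTest.
Variables (R : realType) (n r : nat) (S : set (cspace R n)).
Hypothesis oS : open S.
Implicit Types (D : cspace R n -> 'M[R[i]]_r) (u w v s : 'cV[R[i]]_r)
  (p : cspace R n) (c : 'rV[R[i]]_n).

Definition mxdz (k : 'I_n) D p : 'M[R[i]]_r := \matrix_(a, b) dz k (fun q => D q a b) p.
Definition mxdzbar (k : 'I_n) D p : 'M[R[i]]_r :=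
  \matrix_(a, b) dzbar k (fun q => D q a b) p.

Definition mxC2 D := forall a b, cC2 S (fun q => D q a b).

(** For fixed u and w the form is a linear combination of the entries of M with constant
    coefficients, to which the rules for sums apply. *)
Lemma sesq_pairE (M : 'M[R[i]]_r) u w :
  sesq M u w = \sum_(ab : 'I_r * 'I_r) (Num.conj (u ab.1 0) * w ab.2 0) * M ab.1 ab.2.
Proof.
rewrite /sesq pair_bigA; apply: eq_bigr => ab _ /=.
by rewrite mulrAC.
Qed.

Lemma cC2_sesq D u w : mxC2 D -> cC2 S (fun q => sesq (D q) u w).
Proof.
move=> CD; under eq_fun do rewrite sesq_pairE.
by apply: (cC2_sum oS) => -[a b]; apply: (cC2Z oS); exact: CD.
Qed.

Lemma dz_sesq D u w k p : mxC2 D -> S p ->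
  dz k (fun q => sesq (D q) u w) p = sesq (mxdz k D p) u w.
Proof.
move=> CD Sp; under [X in dz _ X]eq_fun do rewrite sesq_pairE.
rewrite sesq_pairE (dz_sum (S := S)) //; last by move=> ab; apply: cC2_cC1; exact: CD.
by apply: eq_bigr => ab _; rewrite mxE.
Qed.

Lemma dzbar_sesq D u w k p : (forall a b, cC1 S (fun q => D q a b)) -> S p ->
  dzbar k (fun q => sesq (D q) u w) p = sesq (mxdzbar k D p) u w.
Proof.
move=> CD Sp; under [X in dzbar _ X]eq_fun do rewrite sesq_pairE.
rewrite sesq_pairE (dzbar_sum _ _ _ (fun ab => CD ab.1 ab.2) Sp).
by apply: eq_bigr => ab _; rewrite mxE.
Qed.

Lemma mxC2_mxdz D k : mxC2 D -> forall a b, cC1 S (fun q => mxdz k D q a b).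
Proof.
move=> CD a b; have := cC2_dz oS k (CD a b).
by congr cC1; apply/funext => q; rewrite mxE.
Qed.

(** Along xi the vector moves as v + x s. Expanding D at this vector in powers of x gives the
    coefficients A, B and C of [parabola_test]. *)
Let parabola D p v s xi : mxC2 D -> S p ->
  (forall q, S q -> forall u, 0 <= sesq (D q) u u) -> sesq (D p) v v = 0 ->
  0 <= 'D_xi ('D_xi (fun q => complex.Re (sesq (D q) v v))) p +
    2 * complex.Re (cderive xi (fun q => sesq (D q) s v) p +
                    cderive xi (fun q => sesq (D q) v s) p) +
    2 * complex.Re (sesq (D p) s s).
Proof.
move=> CD Sp D0 Dv.
have C u w := cC2_sesq u w CD.
have d u w : cderivable xi (fun q => sesq (D q) u w) p.
  exact: cC1_cderivable (cC2_cC1 (C u w)) Sp.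
have <- : 'D_xi (fun q => complex.Re (sesq (D q) s v + sesq (D q) v s)) p =
  complex.Re (cderive xi (fun q => sesq (D q) s v) p +
                    cderive xi (fun q => sesq (D q) v s) p).
  by have [[_ ->] _] := is_cderiveD (d s v) (d v s).
have [CA _] := C v v; have [CB _] := cC2D oS (C s v) (C v s); have [CC _] := C s s.
apply: (parabola_test oS Sp CA CB CC); first by rewrite Dv.
move=> x Sx; set M := D _.
have /= : 0 <= sesq M (v + x%:C%C *: s) (v + x%:C%C *: s) by apply: D0.
rewrite !(sesqDl, sesqDr, sesqZl, sesqZr) lecE => /andP[_] /=.
move: (sesq M v v) (sesq M v s) (sesq M s v) (sesq M s s).
move=> [a a'] [b b'] [e e'] [f f'] /=; congr (0 <= _); ring.
Qed.

(* Sum of the second-derivative tests along the real directions c and i c, with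
   the vector v moving at speed s, resp. i s. *)
Lemma directional_test D p v s c : mxC2 D -> S p ->
  (forall q, S q -> forall u, 0 <= sesq (D q) u u) -> sesq (D p) v v = 0 ->
  0 <= complex.Re (
    \sum_k \sum_j c 0 j * Num.conj (c 0 k) * sesq (mxdzbar k (mxdz j D) p) v v +
    \sum_j c 0 j * sesq (mxdz j D p) s v +
    \sum_j Num.conj (c 0 j) * sesq (mxdzbar j D p) v s +
    sesq (D p) s s).
Proof.
move=> CD Sp D0 Dv.
have C u w := cC2_sesq u w CD; have C1 u w := cC2_cC1 (C u w).
have := parabola s (cvec c) CD Sp D0 Dv.
have := parabola ('i *: s) (cvec ('i *: c)) CD Sp D0 Dv.
have E : \sum_k \sum_j c 0 j * Num.conj (c 0 k) * sesq (mxdzbar k (mxdz j D) p) v v =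
    \sum_k \sum_j c 0 j * Num.conj (c 0 k) * dzbar k (dz j (fun q => sesq (D q) v v)) p.
  apply: eq_bigr => k _; apply: eq_bigr => j _; congr (_ * _).
  rewrite -(dzbar_sesq _ _ _ (mxC2_mxdz j CD) Sp) /dzbar /dx /dy.
  have e q : S q -> sesq (mxdz j D q) v v = dz j (fun q => sesq (D q) v v) q.
    by move=> Sq; rewrite dz_sesq.
  by congr (_ * (_ + _ * _)); apply: cderive_near; exact: near_open e.
have := levi_real oS c (C v v) Sp (fun q Sq => ger0_Im (D0 q Sq v)).
rewrite -E => L.
have -> : \sum_j c 0 j * sesq (mxdz j D p) s v =
    \sum_j c 0 j * dz j (fun q => sesq (D q) s v) p.
  by apply: eq_bigr => j _; rewrite dz_sesq.
have -> : \sum_j Num.conj (c 0 j) * sesq (mxdzbar j D p) v s =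
    \sum_j Num.conj (c 0 j) * dzbar j (fun q => sesq (D q) v s) p.
  by apply: eq_bigr => j _; rewrite dzbar_sesq // => a b; exact/cC2_cC1/CD.
rewrite (sum_dz oS _ (C1 _ _) Sp) (sum_dzbar oS _ (C1 _ _) Sp).
have -> : cderive (cvec ('i *: c)) (fun q => sesq (D q) ('i *: s) v) p =
    Num.conj 'i * cderive (cvec ('i *: c)) (fun q => sesq (D q) s v) p.
  under [X in cderive _ X]eq_fun do rewrite sesqZl.
  by apply: is_cderiveE; apply: is_cderiveZ; exact: cC1_cderivable (C1 _ _) Sp.
have -> : cderive (cvec ('i *: c)) (fun q => sesq (D q) v ('i *: s)) p =
    'i * cderive (cvec ('i *: c)) (fun q => sesq (D q) v s) p.
  under [X in cderive _ X]eq_fun do rewrite sesqZr.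
  by apply: is_cderiveE; apply: is_cderiveZ; exact: cC1_cderivable (C1 _ _) Sp.
rewrite sesqZl sesqZr => t2 t1.
exact: (directional_algebra L t1 t2).
Qed.

End DirectionalTest.

(** * Positive Hermitian matrices and completion of the square *)

Section HermitianPositive.
Variables (R : realType) (r : nat).
Implicit Types (M N A B H K : 'M[R[i]]_r) (u w v s : 'cV[R[i]]_r).

Definition adjmx M := (map_mx Num.conj M)^T.

Definition herm M := adjmx M = M.

Definition posherm M := herm M /\ forall u, u != 0 -> 0 < sesq M u u.

Lemma sesq1r M u w : sesq 1%:M u (M *m w) = sesq M u w.
Proof. by rewrite sesq_mulmx mul1mx. Qed.

Lemma sesq1l M u w : sesq 1%:M (M *m u) w = sesq (adjmx M) u w.
Proof. by rewrite sesq_mulmxl mulmx1. Qed.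

(** A nonzero kernel vector u would give u^* M u = 0. The determinant is transposed because [det0P]
    yields a left kernel vector. *)
Lemma posherm_unit M : posherm M -> M \in unitmx.
Proof.
move=> [_ pM]; rewrite unitmxE unitfE -det_tr; apply/negP => /det0P[u u0 uM].
have uT0 : u^T != 0 by apply: contra u0 => /eqP/(congr1 trmx); rewrite trmxK trmx0 => ->.
have /= := pM _ uT0; rewrite -sesq1r.
have -> : M *m u^T = 0 by rewrite -[M]trmxK -trmx_mul uM trmx0.
by rewrite sesqE mulmx0 mxE ltxx.
Qed.

Lemma posherm_ge0 M u : posherm M -> 0 <= sesq M u u.
Proof.
move=> [_ pM]; have [->|u0] := eqVneq u 0; last exact/ltW/pM.
by rewrite sesqE mulmx0 mxE.
Qed.

Lemma sesq_comb (n : nat) (a : 'I_n -> R[i]) (m : R[i]) (X Y : 'I_n -> 'M[R[i]]_r) u w :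
  sesq (m *: (\sum_j a j *: X j) - \sum_j a j *: Y j) u w =
  \sum_j a j * sesq (m *: X j - Y j) u w.
Proof.
rewrite scaler_sumr -sumrB sesq_sum; apply: eq_bigr => j _.
by rewrite scalerA [m * _]mulrC -scalerA -scalerBr sesqZ.
Qed.

Lemma sum_comb (n : nat) (a X X' Y Y' : 'I_n -> 'I_n -> R[i]) (m : R[i]) :
  \sum_k \sum_j a k j * (m * (X k j - Y k j) - (X' k j - Y' k j)) =
  \sum_k \sum_j a k j * (m * X k j - X' k j) -
  (m * (\sum_k \sum_j a k j * Y k j) - \sum_k \sum_j a k j * Y' k j).
Proof.
rewrite mulr_sumr -sumrB -sumrB; apply: eq_bigr => k _.
rewrite mulr_sumr -sumrB -sumrB; apply: eq_bigr => j _; ring.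
Qed.

(** Put w = K^-1 B v, so that z = w + s. Using H s = - A v and K w = B v, both sides become
    polynomials in m and six scalars. The vector s is the speed that cancels the covariant
    derivative, and z^* K z is the completed square. *)
Lemma complete_square H K A B v (m : R[i]) :
  herm K -> H \in unitmx -> K \in unitmx ->
  let s := - (invmx H *m A *m v) in let z := invmx K *m B *m v + s in
  m * sesq (adjmx A *m invmx H *m A) v v - sesq (adjmx B *m invmx K *m B) v v =
  - (sesq (m *: A - B) s v + sesq (m *: adjmx A - adjmx B) v s +
     sesq (m *: H - K) s s + sesq K z z).
Proof.
move=> hK uH uK s z.
pose w := invmx K *m B *m v.
have Hs : H *m s = - (A *m v) by rewrite /s mulmxN !mulmxA mulmxV // mul1mx.
have Kw : K *m w = B *m v by rewrite /w !mulmxA mulmxV // mul1mx.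
have -> : sesq (adjmx A *m invmx H *m A) v v = - sesq (adjmx A) v s.
  by rewrite /s sesqNr opprK sesq_mulmx !mulmxA.
have -> : sesq (adjmx B *m invmx K *m B) v v = sesq (adjmx B) v w.
  by rewrite /w sesq_mulmx !mulmxA.
have KE u u' : sesq K u u' = sesq 1%:M (K *m u) u' by rewrite sesq1l hK.
have -> : sesq K z z = sesq (adjmx B) v w + sesq (adjmx B) v s + sesq B s v + sesq K s s.
  rewrite /z -/w sesqDl !sesqDr !(KE w) Kw !sesq1l -[sesq K s w]sesq1r Kw sesq1r.
  by rewrite !addrA.
have Hss : sesq H s s = - sesq A s v by rewrite -sesq1r Hs sesqNr sesq1r.
rewrite !sesqB !sesqZ Hss.
move: (sesq (adjmx A) v s) (sesq (adjmx B) v w) (sesq A s v) (sesq B s v)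
  (sesq (adjmx B) v s) (sesq K s s) => a b c d e f; ring.
Qed.

Section Algebra.
Variables (n : nat) (c : 'I_n -> R[i]) (H : 'M[R[i]]_r) (H1 H1b : 'I_n -> 'M[R[i]]_r).
Hypothesis H1bE : forall k, H1b k = adjmx (H1 k).

Let A := \sum_j c j *: H1 j.

Lemma adjmx_sum : adjmx A = \sum_k Num.conj (c k) *: H1b k.
Proof.
rewrite /A /adjmx rmorph_sum linear_sum; apply: eq_bigr => k _ /=.
by rewrite map_mxZ linearZ /= H1bE.
Qed.

Lemma sesq_sum2 (M : 'M[R[i]]_r) u w :
  \sum_k \sum_j c j * Num.conj (c k) * sesq (H1b k *m M *m H1 j) u w =
  sesq (adjmx A *m M *m A) u w.
Proof.
rewrite adjmx_sum !mulmx_suml sesq_sum; apply: eq_bigr => k _.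
rewrite mulmx_sumr sesq_sum; apply: eq_bigr => j _.
by rewrite -scalemxAr -!scalemxAl scalerA sesqZ.
Qed.

End Algebra.

(** [complete_square] for the contractions A and B of the first derivatives with c. [H1], [H1b] and
    [H2] stand for the d, dbar and dbar d derivatives of H; the right side is the expression of
    [directional_test] plus the square z^* K z. *)
Lemma chern_lap_algebra (n : nat) (c : 'I_n -> R[i]) (m : R[i]) (H K : 'M[R[i]]_r)
    (H1 H1b K1 K1b : 'I_n -> 'M[R[i]]_r) (H2 K2 : 'I_n -> 'I_n -> 'M[R[i]]_r) v :
  posherm H -> posherm K ->
  (forall k, H1b k = adjmx (H1 k)) -> (forall k, K1b k = adjmx (K1 k)) ->
  exists s z,
  \sum_k \sum_j c j * Num.conj (c k) *
    (m * sesq (H2 k j - H1b k *m invmx H *m H1 j) v v -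
     sesq (K2 k j - K1b k *m invmx K *m K1 j) v v) =
  \sum_k \sum_j c j * Num.conj (c k) * sesq (m *: H2 k j - K2 k j) v v +
  \sum_j c j * sesq (m *: H1 j - K1 j) s v +
  \sum_j Num.conj (c j) * sesq (m *: H1b j - K1b j) v s +
  sesq (m *: H - K) s s + sesq K z z.
Proof.
move=> pH pK H1bE K1bE; have [hK _] := pK.
pose A := \sum_j c j *: H1 j; pose B := \sum_j c j *: K1 j.
exists (- (invmx H *m A *m v)), (invmx K *m B *m v - invmx H *m A *m v).
rewrite -!sesq_comb -(adjmx_sum _ H1bE) -(adjmx_sum _ K1bE) -/A -/B.
have := complete_square A B v m hK (posherm_unit pH) (posherm_unit pK).
rewrite /= -(sesq_sum2 _ H1bE) -(sesq_sum2 _ K1bE) => E.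
under eq_bigr do under eq_bigr do rewrite !sesqB.
rewrite sum_comb E opprK !addrA; do 4 congr (_ + _).
by apply: eq_bigr => k _; apply: eq_bigr => j _; rewrite sesqB sesqZ.
Qed.

End HermitianPositive.

(** * Second-order comparison of two metrics at a touching point *)

Section MetricComparison.
Variables (R : realType) (n r : nat) (S : set (cspace R n)).
Hypothesis oS : open S.
Implicit Types (D H K : cspace R n -> 'M[R[i]]_r) (v : 'cV[R[i]]_r)
  (p : cspace R n) (c : 'rV[R[i]]_n).

Lemma dzbar_conj k (F : cspace R n -> R[i]) p : cC1 S F -> S p ->
  dzbar k (fun q => Num.conj (F q)) p = Num.conj (dz k F p).
Proof.
move=> CF Sp.
have E (xi : cspace R n) : cderive xi (fun q => Num.conj (F q)) p = Num.conj (cderive xi F p).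
  apply: is_cderiveE; have [dr di] := cC1_cderivable xi CF Sp.
  split; rewrite complex_simpE.
    by move: dr; congr is_derive; apply/funext => q; rewrite complex_Re_conj.
  by have := is_deriveN di; congr is_derive; apply/funext => q; rewrite complex_Im_conj.
rewrite /dzbar /dz /dx /dy !E; move: (cderive _ _ _) (cderive _ _ _) => x y.
rewrite -complexiE complex_inv2; move: x y => [a a'] [b b'].
by apply: complex_ext => /=; ring.
Qed.

(** Conjugation exchanges dz and dzbar, and H is its own conjugate transpose. *)
Lemma mxdzbar_herm k H p : mxC2 S H -> S p -> (forall q, S q -> herm (H q)) ->
  mxdzbar k H p = adjmx (mxdz k H p).
Proof.
move=> CH Sp hH; apply/matrixP => a b; rewrite !mxE -(dzbar_conj k (cC2_cC1 (CH b a)) Sp).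
rewrite /dzbar /dx /dy.
have e q : S q -> H q a b = Num.conj (H q b a) by move/hH => {1}<-; rewrite !mxE.
by congr (_ * (_ + _ * _)); apply: cderive_near; exact: near_open e.
Qed.

(* Matrix of H * dbar_k (H^-1 dz_j H). *)
Definition chern_lap H p (k j : 'I_n) : 'M[R[i]]_r :=
  mxdzbar k (mxdz j H) p - mxdzbar k H p *m invmx (H p) *m mxdz j H p.

Lemma mxdz_comb (m : R[i]) H K k p : mxC2 S H -> mxC2 S K -> S p ->
  mxdz k (fun q => m *: H q - K q) p = m *: mxdz k H p - mxdz k K p.
Proof.
move=> CH CK Sp; apply/matrixP => a b; rewrite !mxE /dz /dx /dy.
have E (xi : cspace R n) : cderive xi (fun q => (m *: H q - K q) a b) p =
    m * cderive xi (fun q => H q a b) p + (-1) * cderive xi (fun q => K q a b) p.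
  have CHab := cC1_cderivable xi (cC2_cC1 (CH a b)) Sp.
  have CKab := cC1_cderivable xi (cC2_cC1 (CK a b)) Sp.
  apply: is_cderiveE.
  have := is_cderiveD (is_cderiveZ m CHab) (is_cderiveZ (-1) CKab).
  by congr is_cderive; apply/funext => q; rewrite !mxE mulN1r.
rewrite !E; move: (cderive _ _ _) (cderive _ _ _) (cderive _ _ _) (cderive _ _ _) => x y x' y'.
by ring.
Qed.

(** Stated for C^1 entries because it is also applied to the first derivatives [mxdz j H]. *)
Lemma mxdzbar_comb (m : R[i]) H K k p : (forall a b, cC1 S (fun q => H q a b)) ->
  (forall a b, cC1 S (fun q => K q a b)) -> S p ->
  mxdzbar k (fun q => m *: H q - K q) p = m *: mxdzbar k H p - mxdzbar k K p.
Proof.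
move=> CH CK Sp; apply/matrixP => a b; rewrite !mxE /dzbar /dx /dy.
have E (xi : cspace R n) : cderive xi (fun q => (m *: H q - K q) a b) p =
    m * cderive xi (fun q => H q a b) p + (-1) * cderive xi (fun q => K q a b) p.
  have CHab := cC1_cderivable xi (CH a b) Sp.
  have CKab := cC1_cderivable xi (CK a b) Sp.
  apply: is_cderiveE.
  have := is_cderiveD (is_cderiveZ m CHab) (is_cderiveZ (-1) CKab).
  by congr is_cderive; apply/funext => q; rewrite !mxE mulN1r.
rewrite !E; move: (cderive _ _ _) (cderive _ _ _) (cderive _ _ _) (cderive _ _ _) => x y x' y'.
by ring.
Qed.

Lemma mxC2_comb (m : R[i]) H K : mxC2 S H -> mxC2 S K ->
  mxC2 S (fun q => m *: H q - K q).
Proof.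
move=> CH CK a b; have := cC2D oS (cC2Z oS m (CH a b)) (cC2Z oS (-1) (CK a b)).
by congr cC2; apply/funext => q; rewrite !mxE mulN1r.
Qed.

(** Take D = m H - K, with m constant in space. [chern_lap_algebra] writes the sum as the quantity
    of [directional_test], whose real part is nonnegative, plus the nonnegative square z^* K z. *)
Lemma chern_lap_comparison (m : R[i]) H K p v c :
  mxC2 S H -> mxC2 S K -> S p ->
  (forall q, S q -> posherm (H q)) -> (forall q, S q -> posherm (K q)) ->
  (forall q, S q -> forall u, 0 <= sesq (m *: H q - K q) u u) ->
  sesq (m *: H p - K p) v v = 0 ->
  0 <= complex.Re (\sum_k \sum_j c 0 j * Num.conj (c 0 k) *
    (m * sesq (chern_lap H p k j) v v - sesq (chern_lap K p k j) v v)).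
Proof.
move=> CH CK Sp pH pK D0 Dv.
have adjE (M : cspace R n -> 'M[R[i]]_r) : mxC2 S M ->
    (forall q, S q -> posherm (M q)) -> forall k, mxdzbar k M p = adjmx (mxdz k M p).
  by move=> CM pM k; apply: mxdzbar_herm => // q /pM[].
have [s [z E]] := chern_lap_algebra (fun j => c 0 j) m
  (fun k j => mxdzbar k (mxdz j H) p) (fun k j => mxdzbar k (mxdz j K) p) v
  (pH p Sp) (pK p Sp) (adjE H CH pH) (adjE K CK pK).
rewrite /chern_lap E complex_ReD addr_ge0 //; last first.
  by have := posherm_ge0 z (pK p Sp); rewrite lecE => /andP[].
have := directional_test oS s c (mxC2_comb m CH CK) Sp D0 Dv.
congr (0 <= complex.Re (_ + _ + _ + _)).
- apply: eq_bigr => k _; apply: eq_bigr => j _; congr (_ * sesq _ _ _).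
  rewrite -(mxdzbar_comb m k (mxC2_mxdz oS j CH) (mxC2_mxdz oS j CK) Sp).
  apply/matrixP => a b; rewrite !mxE /dzbar /dx /dy.
  have e q : S q -> mxdz j (fun q => m *: H q - K q) q a b =
    (m *: mxdz j H q - mxdz j K q) a b by move=> Sq; rewrite (mxdz_comb m j CH CK Sq).
  by congr (_ * (_ + _ * _)); apply: cderive_near; exact: near_open e.
- by apply: eq_bigr => j _; rewrite (mxdz_comb m j CH CK Sp).
- apply: eq_bigr => j _.
  by rewrite (mxdzbar_comb m j (fun a b => cC2_cC1 (CH a b)) (fun a b => cC2_cC1 (CK a b)) Sp).
Qed.

End MetricComparison.

(** * Trace against the Kaehler form *)

Section KaehlerTrace.
Variables (R : realType) (n : nat).
Implicit Types (w a : 'M[R[i]]_n).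

Local Notation gmx w := ((- 'i) *: w).

(** [positive11] conjugates the vector at the second index of the matrix and [sesq] at the first,
    hence the transpose. *)
Lemma positive11_posherm w : positive11 w -> posherm (gmx w)^T.
Proof.
move=> [gh gp]; split.
  by apply/matrixP => j k; rewrite !mxE gh conjCK.
move=> u u0; have uT0 : u^T != 0.
  by apply: contra u0 => /eqP/(congr1 trmx); rewrite trmxK trmx0 => ->.
have := gp _ uT0; congr (0 < _).
rewrite exchange_big; apply: eq_bigr => k _; apply: eq_bigr => j _; rewrite !mxE.
by move: (w j k) (u j 0) (Num.conj (u k 0)) => x y z; ring.
Qed.

Lemma positive11_unit w : positive11 w -> gmx w \in unitmx.
Proof. by move=> /positive11_posherm/posherm_unit; rewrite unitmx_tr. Qed.

(** In the inner product of a with w itself one of the two inverse matrices cancels against w, and a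
    single trace remains. *)
Lemma Lambda11E w a : positive11 w ->
  Lambda11 w a = - 'i * \sum_k \sum_j invmx (gmx w) k j * a j k.
Proof.
move=> pw; have [gh _] := pw; have ug := positive11_unit pw.
rewrite /Lambda11 /inner11 /=; set G := invmx _.
(* w = i g with g Hermitian; conjugating produces the factor -i. *)
have wh l m : Num.conj (w l m) = - 'i * gmx w m l.
  rewrite mxE gh complex_conj_iNM mulrA mulNr complex_sqr_i opprK.
  by rewrite mul1r.
rewrite exchange_big mulr_sumr; apply: eq_bigr => k _.
rewrite mulr_sumr; apply: eq_bigr => j _.
transitivity (\sum_l (- 'i * a j k * G l j) * (\sum_m G k m * gmx w m l)).
  apply: eq_bigr => l _; rewrite mulr_sumr; apply: eq_bigr => m _.
  rewrite wh; move: (gmx w m l) (a j k) (G l j) (G k m) => x y z t; ring.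
have E l : \sum_m G k m * gmx w m l = (k == l)%:R.
  by have /matrixP/(_ k l) := mulVmx ug; rewrite mxE => ->; rewrite mxE.
rewrite (bigD1 k) //= E eqxx mulr1 big1 ?addr0 => [|l lk].
  by rewrite -mulrA [a j k * _]mulrC.
by rewrite E eq_sym (negbTE lk) mulr0.
Qed.

(** In a unitary eigenbasis, the inverse of g is a combination of the rank-one forms of the rows of
    P with coefficients 1 / d_a > 0, so the trace is the same combination of the sums in the
    hypothesis. *)
Lemma Re_trace_ge0 w (N : 'I_n -> 'I_n -> R[i]) : positive11 w ->
  (forall c : 'rV[R[i]]_n,
    0 <= complex.Re (\sum_k \sum_j c 0 j * Num.conj (c 0 k) * N k j)) ->
  0 <= complex.Re (\sum_k \sum_j invmx (gmx w) k j * N k j).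
Proof.
move=> pw N0; have [gh gp] := pw; have ug := positive11_unit pw.
set g := gmx w in gh gp ug *.
have herm_g : g \is hermsymmx.
  apply/is_hermitianmxP; rewrite expr0 scale1r; apply/matrixP => j k.
  by rewrite !mxE gh.
have /orthomx_spectralP := hermitian_normalmx herm_g.
set P := spectralmx g; set d := spectral_diag g => gE.
have Punit : P \in unitmx := spectral_unit g.
have Pinv (a k : 'I_n) : invmx P k a = Num.conj (P a k).
  by rewrite invmx_unitary ?spectral_unitarymx // !mxE.
(* The eigenvalue d_a is the value of the positive form on row a of P, which is nonzero because P is
   invertible. *)
have d_gt0 (a : 'I_n) : 0 < d 0 a.
  have -> : d 0 a = \sum_j \sum_k (- 'i) * w j k * row a P 0 j * Num.conj (row a P 0 k).
    have /matrixP/(_ a a) : P *m g *m invmx P = diag_mx d.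
      by rewrite gE !mulmxA mulmxV // mul1mx mulmxK.
    rewrite [RHS]mxE eqxx mulr1n => <-; rewrite mxE exchange_big.
    apply: eq_bigr => k _; rewrite mxE mulr_suml; apply: eq_bigr => j _.
    by rewrite Pinv !mxE [P a j * _]mulrC.
  apply: gp; apply/eqP => Pa0.
  have /matrixP/(_ a a) := mulmxV Punit; rewrite !mxE eqxx big1 => [/eqP|k _].
    by rewrite eq_sym oner_eq0.
  by have /matrixP/(_ 0 k) := Pa0; rewrite !mxE => ->; rewrite mul0r.
pose d' : 'rV[R[i]]_n := \row_a (d 0 a)^-1.
have dd' : diag_mx d *m diag_mx d' = 1%:M.
  rewrite mulmx_diag -diag_const_mx; congr diag_mx; apply/rowP => a; rewrite !mxE.
  by rewrite mulfV // gt_eqF.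
have GE : invmx g = invmx P *m diag_mx d' *m P.
  have : g *m (invmx P *m diag_mx d' *m P) = 1%:M.
    rewrite gE !mulmxA mulmxK // -[invmx P *m _ *m _]mulmxA dd' mulmx1.
    by rewrite mulVmx.
  by move/(congr1 (mulmx (invmx g))); rewrite (mulKmx ug) mulmx1 => ->.
have -> : \sum_k \sum_j invmx g k j * N k j = \sum_a (d 0 a)^-1 *
    \sum_k \sum_j row a P 0 j * Num.conj (row a P 0 k) * N k j.
  transitivity (\sum_k \sum_j \sum_a (d 0 a)^-1 *
      (row a P 0 j * Num.conj (row a P 0 k) * N k j)).
    apply: eq_bigr => k _; apply: eq_bigr => j _.
    rewrite GE mxE mulr_suml; apply: eq_bigr => a _.
    rewrite mul_mx_diag !mxE Pinv.
    move: (d 0 a)^-1 (P a k) (P a j) (N k j) => x y z t; ring.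
  under eq_bigr do rewrite exchange_big.
  rewrite exchange_big; apply: eq_bigr => a _ /=; rewrite mulr_sumr.
  by apply: eq_bigr => k _; rewrite mulr_sumr.
rewrite complex_Re_sum sumr_ge0 // => a _.
have : 0 <= (d 0 a)^-1 by rewrite invr_ge0 ltW.
rewrite lecE complex_ReM => /andP[/eqP -> /= ?].
by rewrite mul0r subr0 mulr_ge0.
Qed.

End KaehlerTrace.

(** * Metrics in local frames *)

Section InverseDerivative.
Variables (R : realType) (n r : nat) (S : set (cspace R n)).
Hypothesis oS : open S.
Implicit Types (H W : cspace R n -> 'M[R[i]]_r) (p : cspace R n).

Lemma cderivable_det v (m : nat) (M : cspace R n -> 'M[R[i]]_m) p :
  (forall a b, cderivable v (fun q => M q a b) p) ->
  cderivable v (fun q => \det (M q)) p.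
Proof.
move=> dM; rewrite /determinant; apply: cderivable_sum => s _.
by apply: cderivableZ; apply: cderivable_prod => a; exact: dM.
Qed.

(** Cramer's rule: near p the entries of the inverse are cofactors divided by the determinant. *)
Lemma cderivable_invmx v H p : S p -> (forall q, S q -> H q \in unitmx) ->
  (forall a b, cderivable v (fun q => H q a b) p) ->
  forall a b, cderivable v (fun q => invmx (H q) a b) p.
Proof.
move=> Sp uH dH a b.
have dc : cderivable v (fun q => cofactor (H q) b a) p.
  apply: cderivableZ; apply: cderivable_det => c d.
  under eq_fun do rewrite !mxE.
  exact: dH.
have det0 : \det (H p) != 0 by rewrite -unitfE -unitmxE uH.
have dV := cderivableV det0 (cderivable_det dH).
apply: (is_cderive_ex (is_cderive_near _ (is_cderiveM dV dc))).
by apply: near_open (oS) Sp _ => q Sq; rewrite /invmx uH // !mxE.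
Qed.

Lemma mxdzbar_mul H W k p :
  (forall v a b, cderivable v (fun q => H q a b) p) ->
  (forall v a b, cderivable v (fun q => W q a b) p) ->
  mxdzbar k (fun q => H q *m W q) p = mxdzbar k H p *m W p + H p *m mxdzbar k W p.
Proof.
move=> dH dW; apply/matrixP => a b; rewrite !mxE -big_split /= /dzbar /dx /dy.
have E v : cderive v (fun q => (H q *m W q) a b) p =
    \sum_c (cderive v (fun q => H q a c) p * W p c b +
            H p a c * cderive v (fun q => W q c b) p).
  apply: is_cderiveE; under eq_fun do rewrite mxE.
  exact: (is_cderive_sum _ (fun c _ => is_cderiveM (dH v a c) (dW v c b))).
rewrite !E mulr_sumr -big_split mulr_sumr; apply: eq_bigr => c _; rewrite !mxE /=.
rewrite /dzbar /dx /dy.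
move: (cderive _ _ _) (cderive _ _ _) (cderive _ _ _) (cderive _ _ _) (W p c b) (H p a c).
by move=> x y z t s u; ring.
Qed.

(** Apply dbar_k to H (H^-1 d_l H) = d_l H and use the product rule. *)
Lemma mxdzbar_connection H k l p : mxC2 S H -> S p ->
  (forall q, S q -> H q \in unitmx) ->
  H p *m mxdzbar k (fun q => invmx (H q) *m mxdz l H q) p = chern_lap H p k l.
Proof.
move=> CH Sp uH; pose W q := invmx (H q) *m mxdz l H q.
have dH v a b : cderivable v (fun q => H q a b) p.
  exact: cC1_cderivable (cC2_cC1 (CH a b)) Sp.
have dW v a b : cderivable v (fun q => W q a b) p.
  have e : (fun q => W q a b) = (fun q => \sum_c invmx (H q) a c * mxdz l H q c b).
    by apply/funext => q; rewrite mxE.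
  rewrite e; apply: cderivable_sum => c _; apply: cderivableM.
    exact: cderivable_invmx.
  exact: cC1_cderivable (mxC2_mxdz oS l CH c b) Sp.
have := mxdzbar_mul k dH dW.
have -> : mxdzbar k (fun q => H q *m W q) p = mxdzbar k (mxdz l H) p.
  apply/matrixP => a b; rewrite !mxE /dzbar /dx /dy.
  have e q : S q -> (H q *m W q) a b = mxdz l H q a b.
    by move=> Sq; rewrite mulmxA mulmxV ?uH // mul1mx.
  by congr (_ * (_ + _ * _)); apply: cderive_near; exact: near_open e.
by rewrite /chern_lap /W mulmxA => ->; rewrite addrC addKr.
Qed.

End InverseDerivative.

(** * Gram matrices and the flow equation in a frame *)

Section BundleMetric.
Variables (R : realType) (n r : nat) (X : complexManifold R n) (E : holBundle X r).
Implicit Types (h : hermMetric E) (i : chart_idx X) (j : triv_idx E) (x : X).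

(** On the open chart image [chartV i] is continuous, so it maps a neighbourhood of each point of
    the set into the open [triv_dom j]. *)
Lemma bundle_img_open i j : open (bundle_img i j).
Proof.
have oI := @chart_img_open _ _ X i.
rewrite openE => p [x [ix jx] <-]; rewrite /interior.
have Ip : (chart i @` chart_dom i) (chart i x) by exists x.
have := @chartV_cont _ _ X i; rewrite continuous_open_subspace // => cV.
have : {for chart i x, continuous (chartV i)} by apply: cV; rewrite inE.
rewrite /prop_for /continuous_at (chartK ix) => cVx.
have nj : nbhs x (triv_dom j) by apply: open_nbhs_nbhs; split => //; exact: (@triv_dom_open _ _ _ _ E j).
have := cVx _ nj; rewrite nbhs_simpl /= => nVj.
have nI : nbhs (chart i x) (chart i @` chart_dom i) by exact: open_nbhs_nbhs.
apply: filterS2 nI nVj => q [y iy <-]; rewrite /= (chartK iy) => jy.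
by exists y.
Qed.

Lemma bundle_imgP i j p : bundle_img i j p ->
  chart_dom i (chartV i p) /\ triv_dom j (chartV i p) /\ chart i (chartV i p) = p.
Proof. by move=> [x [ix jx] <-]; rewrite (chartK ix). Qed.

Lemma linear_comb_fun (U V : lmodType R[i]) (f : U -> V) (I : Type) (s : seq I)
    (a : I -> R[i]) (u : I -> U) : linear f ->
  f (\sum_(k <- s) a k *: u k) = \sum_(k <- s) a k *: f (u k).
Proof.
move=> lf; elim: s => [|k s IH]; last by rewrite !big_cons lf IH.
by rewrite !big_nil -[X in f X](addNr 0) -scaleN1r lf scaleN1r addNr.
Qed.

Lemma triv_frame j x (u : fib E x) : triv_dom j x ->
  u = \sum_b triv j u b 0 *: frame j x b.
Proof.
move=> jx; apply: (can_inj (trivK jx)).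
rewrite (linear_comb_fun _ _ _ (triv_linear jx)).
rewrite [LHS]matrix_sum_delta; apply: eq_bigr => b _.
by rewrite big_ord1 /frame (trivVK jx).
Qed.

Lemma metric_gram h j x (u : fib E x) : triv_dom j x ->
  h x u u = sesq (gram h j x) (triv j u) (triv j u).
Proof.
move=> jx; rewrite {1 2}(triv_frame u jx) linear_sumlz /sesq exchange_big.
apply: eq_bigr => b _; rewrite linear_sumr; apply: eq_bigr => a _.
by rewrite linearZl_LR linearZr_LR !mxE /= mulrC.
Qed.

Lemma gram_metric h j x (u : 'cV[R[i]]_r) : triv_dom j x ->
  sesq (gram h j x) u u = h x (trivV j x u) (trivV j x u).
Proof. by move=> jx; rewrite (metric_gram h _ jx) (trivVK jx). Qed.

Lemma gram_posherm h j x : triv_dom j x -> posherm (gram h j x).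
Proof.
move=> jx; split.
  apply/matrixP => a b; rewrite !mxE [RHS]hermC expr0 mul1r.
  by [].
move=> u u0; rewrite (gram_metric h _ jx); apply: neq0_dnorm_gt0.
apply: contra u0 => /eqP tu.
(* The empty combination says that [triv j] sends 0 to 0, so [trivV j x u = 0] forces u = 0. *)
have := linear_comb_fun [::] (fun=> 0) (fun _ : unit => 0) (triv_linear jx).
by rewrite !big_nil -tu (trivVK jx) => ->.
Qed.

Lemma gram_mxC2 h i j : mxC2 (bundle_img i j) (fun p => gram h j (chartV i p)).
Proof.
move=> a b; apply: cC2_csmooth_on; first exact: bundle_img_open.
exact: hmetric_smooth.
Qed.

(** The flow equation multiplied on the left by H. Since Lambda F = i sum_(k, l) G_kl dbar_k (H^-1
    d_l H), the factor -2i becomes 2, and the term in the Einstein constant becomes 2 i lambda H. *)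
Lemma flow_gram (w : kahlerForm X) (h : R -> hermMetric E) t i j x :
  hermitian_YM_flow w h -> 0 <= t -> chart_dom i x -> triv_dom j x ->
  let H p := gram (h t) j (chartV i p) in
  gram_dt h t j x = 2 *: (\sum_k \sum_l invmx ((- 'i) *: w i x) k l *:
    chern_lap H (chart i x) k l) + (2 * 'i * einstein_const E w) *: gram (h t) j x.
Proof.
move=> [_ hf] t0 ix jx H.
have uH q : bundle_img i j q -> H q \in unitmx.
  by move=> /bundle_imgP[_ [jq _]]; exact/posherm_unit/gram_posherm.
have Sp : bundle_img i j (chart i x) by exists x.
have := congr1 (mulmx (gram (h t) j x)) (hf t i j x t0 ix jx).
rewrite (mulKVmx (posherm_unit (gram_posherm (h t) jx))) => ->.
have -> : Lambda_curvature w (h t) i j x = 'i *: (\sum_k \sum_l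
    invmx ((- 'i) *: w i x) k l *:
    mxdzbar k (fun q => invmx (H q) *m mxdz l H q) (chart i x)).
  apply/matrixP => a b; rewrite mxE (Lambda11E _ (kform_pos w ix)) mxE.
  rewrite mulNr -mulrN; congr ('i * _).
  rewrite summxE -sumrN; apply: eq_bigr => k _; rewrite summxE -sumrN.
  by apply: eq_bigr => l _; rewrite !mxE mulrN opprK.
have HE : gram (h t) j x = H (chart i x) by rewrite /H (chartK ix).
rewrite -scalemxAr mulmxBr -scalemxAr mul_mx_scalar scalerBr !scalerA.
rewrite -[- 2 * 'i * 'i]mulrA complex_sqr_i mulrN1 opprK; congr (_ *: _ + _).
  rewrite HE mulmx_sumr; apply: eq_bigr => k _; rewrite mulmx_sumr.
  apply: eq_bigr => l _; rewrite -scalemxAr.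
  by rewrite (mxdzbar_connection (@bundle_img_open i j) k l (gram_mxC2 (h t) i j) Sp uH).
by rewrite !mulNr scaleNr opprK.
Qed.

End BundleMetric.

(** * The touching point *)

(** Used to read a time derivative at fixed x as a derivative in the direction (1, 0) of the product
    of time and chart coordinates. *)
Lemma eq_within_quot (R : realType) (V W : normedModType R) (S : set V) (T : set W)
    (f : V -> R) (g : W -> R) (p v : V) (q w : W) :
  (forall s : R, S (p + s *: v) <-> T (q + s *: w)) ->
  (forall s : R, f (p + s *: v) = g (q + s *: w)) ->
  within_quot S f p v = within_quot T g q w.
Proof.
move=> ST fg; have := fg 0; rewrite !scale0r !addr0 => fg0; rewrite /within_quot.
have -> : [set s : R | S (p + s *: v)] = [set s : R | T (q + s *: w)].
  by apply/seteqP; split => s /=; apply ST.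
have -> // : (fun s : R => s^-1 * (f (p + s *: v) - f p)) =
  (fun s : R => s^-1 * (g (q + s *: w) - g q)).
by apply/funext => s; rewrite fg fg0.
Qed.

Section TouchingPoint.
Variables (R : realType) (n r : nat) (X : complexManifold R n) (E : holBundle X r).
Implicit Types (h : R -> hermMetric E) (i : chart_idx X) (j : triv_idx E) (x : X).

(** A positive derivative at the zero t would make f negative just before t. *)
Lemma derive_le0_left (f : R -> R) (t d : R) : 0 < t -> is_derive t (1 : R) f d ->
  f t = 0 -> (forall s, 0 <= s <= t -> 0 <= f s) -> d <= 0.
Proof.
move=> t0 [df <-] ft f_ge0; rewrite leNgt; apply/negP => dpos.
have : \forall s \near (0 : R)^', 0 < s^-1 *: (f (s *: 1 + t) - f t).
  by apply: cvgr_gt dpos; exact: df.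
move=> /nbhs_ballP[e /= e0 eP].
pose s := Num.min e t / 2.
have m0 : 0 < Num.min e t by rewrite lt_min e0.
have s0 : 0 < s by rewrite divr_gt0.
have sm : s < Num.min e t by rewrite ltr_pdivrMr // ltr_pMr // ltr1n.
have [se st] : s < e /\ s < t by move: sm; rewrite lt_min => /andP.
have := eP (- s); rewrite /ball /= sub0r opprK gtr0_norm // => /(_ se).
rewrite oppr_eq0 gt_eqF // => /(_ isT).
rewrite ft subr0 [(- s)%:A]mulr1 invrN /GRing.scale /= mulNr oppr_gt0.
rewrite pmulr_rlt0 ?invr_gt0 // ltNge => /negP; apply.
by apply: f_ge0; rewrite addrC subr_ge0 (ltW st) gerBl ltW.
Qed.

Lemma is_derive_gram h t i j x a b : smooth_family h -> 0 < t ->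
  chart_dom i x -> triv_dom j x ->
  is_cderive (1 : R) (fun s => gram (h s) j x a b) t (gram_dt h t j x a b).
Proof.
move=> hs t0 ix jx.
pose S := [set q : R * cspace R n | 0 <= q.1 /\ bundle_img i j q.2].
have St : S (t, chart i x) by split; [exact: ltW|exists x].
have main (pr : R[i] -> R) :
    smooth_on S (fun q => pr (gram (h q.1) j (chartV i q.2) a b)) ->
    is_derive t (1 : R) (fun s => pr (gram (h s) j x a b))
      (@derive_within R R [set s | 0 <= s] (fun s => pr (gram (h s) j x a b)) t 1).
  move=> /(_ 1%N)[_ /(_ (1, 0))[/(_ _ St) dS _]].
  have E1 : within_quot S (fun q => pr (gram (h q.1) j (chartV i q.2) a b))
      (t, chart i x) (1, 0) =
      @within_quot R R [set s | 0 <= s] (fun s => pr (gram (h s) j x a b)) t 1.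
    apply: eq_within_quot => s; rewrite /S /= scaler0 addr0 ?(chartK ix) //.
    by split => [[]|] //; split => //; exists x.
  have near0 : \forall s \near (0 : R), [set s : R | 0 <= s] (t + s *: 1).
    have : \forall s \near (0 : R), `|s| < t by exact: nbhs0_lt.
    apply: filterS => s; rewrite ltr_norml => /andP[ts _] /=.
    by rewrite [s%:A]mulr1 -lerBlDl sub0r ltW.
  have E2 := @within_quotE R R [set s : R | 0 <= s]
    (fun s => pr (gram (h s) j x a b)) t 1 near0.
  split; last by rewrite /derive_within E2.
  by move: dS; rewrite /derivable_within E1 E2.
have [sr si] := hs i j a b.
split; rewrite /gram_dt mxE /=.
  exact: (main (@complex.Re R)).
exact: (main (@complex.Im R)).
Qed.

Lemma is_derive_sesq_gram h t i j x (u : 'cV[R[i]]_r) : smooth_family h -> 0 < t ->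
  chart_dom i x -> triv_dom j x ->
  is_cderive (1 : R) (fun s => sesq (gram (h s) j x) u u) t
    (sesq (gram_dt h t j x) u u).
Proof.
move=> hs t0 ix jx; under [X in is_cderive _ X]eq_fun do rewrite sesq_pairE.
rewrite sesq_pairE.
apply: (is_cderive_sum _ (fun ab _ => is_cderiveZ _ (is_derive_gram ab.1 ab.2 hs t0 ix jx))).
Qed.

End TouchingPoint.

(** Here d is the derivative of m, and a and b are the values of the two forms at v. The Einstein
    terms combine into c (m a - b), which vanishes where the metrics touch. *)
Lemma flow_difference (F : comPzRingType) (n : nat) (G A B : 'I_n -> 'I_n -> F)
    (m d c a b : F) :
  d * a + m * (2 * (\sum_k \sum_l G k l * A k l) + c * a) -
    (2 * (\sum_k \sum_l G k l * B k l) + c * b) =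
  d * a + 2 * (\sum_k \sum_l G k l * (m * A k l - B k l)) + c * (m * a - b).
Proof.
have -> : \sum_k \sum_l G k l * (m * A k l - B k l) =
    m * (\sum_k \sum_l G k l * A k l) - \sum_k \sum_l G k l * B k l.
  rewrite mulr_sumr -sumrB; apply: eq_bigr => k _.
  by rewrite mulr_sumr -sumrB; apply: eq_bigr => l _; ring.
ring.
Qed.

(** * Impossibility of touching at a positive time *)

Section NoTouching.
Variables (R : realType) (n r : nat) (X : complexManifold R n) (E : holBundle X r).
Implicit Types (i : chart_idx X) (j : triv_idx E) (x : X).

(** Domination over neighbouring points at time t gives the second-order inequality; domination of v
    over x at earlier times makes the time derivative of v^* (m H - K) v nonpositive. The flow
    equations make this derivative positive because m is strictly increasing. *)
Lemma no_touching (w : kahlerForm X) (g h : R -> hermMetric E) (C eps t : R) x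
    (v : fib E x) :
  hermitian_YM_flow w g -> hermitian_YM_flow w h ->
  0 < C -> 0 < eps -> 0 < t -> v != 0 ->
  let m s : R[i] := (C * (1 + eps * s))%:C%C in
  (forall s y (u : fib E y), 0 <= s <= t -> g s y u u <= m s * h s y u u) ->
  g t x v v <> m t * h t x v v.
Proof.
move=> gf hf C0 e0 t0 v0 m gh gv.
have [i ix] := chart_cover x; pose j := triv_at E x; have jx := triv_cover E x.
rewrite -/j in jx.
pose U := triv j v; pose p := chart i x.
pose H q := gram (h t) j (chartV i q); pose K q := gram (g t) j (chartV i q).
pose S := bundle_img i j.
have oS : open S := @bundle_img_open _ _ _ _ E i j.
have Sp : S p by exists x.
have pos (k : hermMetric E) q : S q -> posherm (gram k j (chartV i q)).
  by move=> /bundle_imgP[_ [jq _]]; exact: gram_posherm.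
have HE : H p = gram (h t) j x by rewrite /H (chartK ix).
have KE : K p = gram (g t) j x by rewrite /K (chartK ix).
have touch : sesq (m t *: H p - K p) U U = 0.
  by rewrite sesqB sesqZ HE KE -!(metric_gram _ v jx) gv subrr.
have tt : 0 <= t <= t by rewrite lexx ltW.
have lap (c : 'rV[R[i]]_n) : 0 <= complex.Re (\sum_k \sum_l c 0 l * Num.conj (c 0 k) *
    (m t * sesq (chern_lap H p k l) U U - sesq (chern_lap K p k l) U U)).
  apply: (@chern_lap_comparison R n r S oS (m t) H K p U c) => //.
  - exact: gram_mxC2.
  - exact: gram_mxC2.
  - by move=> q Sq; exact: pos.
  - by move=> q Sq; exact: pos.
  - move=> q /bundle_imgP[_ [jq _]] u; rewrite sesqB sesqZ !(gram_metric _ _ jq).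
    by rewrite subr_ge0; exact: gh.
have := Re_trace_ge0 (kform_pos w ix) lap.
set G := invmx _; set L := \sum_k _ => L0.
pose f s := m s * sesq (gram (h s) j x) U U - sesq (gram (g s) j x) U U.
pose c := 2 * 'i * einstein_const E w.
have gramE k : hermitian_YM_flow w k -> sesq (gram_dt k t j x) U U =
    2 * (\sum_a \sum_l G a l *
      sesq (chern_lap (fun q => gram (k t) j (chartV i q)) p a l) U U) +
    c * sesq (gram (k t) j x) U U.
  move=> kf; rewrite (flow_gram kf (ltW t0) ix jx) sesqD !sesqZ sesq_sum.
  congr (_ * _ + _); apply: eq_bigr => a _; rewrite sesq_sum.
  by apply: eq_bigr => l _; rewrite sesqZ.
have df : is_cderive (1 : R) f t
    ((C * eps)%:C%C * sesq (gram (h t) j x) U U +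
     m t * sesq (gram_dt h t j x) U U - sesq (gram_dt g t j x) U U).
  have dm : is_cderive (1 : R) m t (C * eps)%:C%C.
    split; last exact: is_derive_cst.
    have := is_deriveZ C (is_deriveD (is_derive_cst (1 : R) t (1 : R))
      (is_deriveZ eps (is_derive_id t (1 : R)))).
    by congr is_derive; rewrite add0r /GRing.scale /= mulr1.
  have [[gs _] [hs _]] := (gf, hf).
  have := is_cderiveD (is_cderiveM dm (is_derive_sesq_gram U hs t0 ix jx))
    (is_cderiveZ (-1) (is_derive_sesq_gram U gs t0 ix jx)).
  congr is_cderive; last by rewrite mulN1r.
  by apply/funext => s; rewrite /f mulN1r.
have dRe : complex.Re ((C * eps)%:C%C * sesq (gram (h t) j x) U U +
     m t * sesq (gram_dt h t j x) U U - sesq (gram_dt g t j x) U U) <= 0.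
  have [dr _] := df.
  apply: (derive_le0_left t0 dr).
    by move: touch; rewrite sesqB sesqZ HE KE -/(f t) => ->.
  move=> s st; have := gh s x v st; rewrite -subr_ge0 !(metric_gram _ v jx).
  by rewrite lecE => /andP[_].
have hpos : 0 < complex.Re (sesq (gram (h t) j x) U U).
  have [_ /(_ U)] := gram_posherm (h t) jx.
  have U0 : U != 0.
    apply: contra v0 => /eqP U0; rewrite (triv_frame v jx) -/U U0 big1 // => b _.
    by rewrite mxE scale0r.
  by move=> /(_ U0); rewrite ltcE => /andP[_].
move: dRe; rewrite !gramE //.
(* The flow equations leave the term from the derivative of m, twice the trace L, and a multiple of
   the touching form, which is zero. *)
have -> : (C * eps)%:C%C * sesq (gram (h t) j x) U U +
     m t * (2 * (\sum_a \sum_l G a l * sesq (chern_lap H p a l) U U) +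
       c * sesq (gram (h t) j x) U U) -
     (2 * (\sum_a \sum_l G a l * sesq (chern_lap K p a l) U U) +
       c * sesq (gram (g t) j x) U U) =
     (C * eps)%:C%C * sesq (gram (h t) j x) U U + (2 : R)%:C%C * L +
     c * sesq (m t *: H p - K p) U U.
  by rewrite sesqB sesqZ HE KE rmorph_nat /L flow_difference.
rewrite touch mulr0 addr0 complex_ReD !complex_ReM /= !mul0r !subr0.
(* C eps H(v, v) is positive and the real part of L is nonnegative. *)
apply/negP; rewrite -ltNge ltr_pwDl // ?mulr_ge0 //.
by rewrite mulr_gt0 // mulr_gt0.
Qed.

End NoTouching.

(** * Compactness *)

Section ComplexLimit.
Variables (R : realType) (Z : Type) (F : set_system Z).
Hypothesis FF : Filter F.
Implicit Types f g : Z -> R[i].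

Definition ccvg f (l : R[i]) := (fun z => complex.Re (f z)) @ F --> complex.Re l /\
  (fun z => complex.Im (f z)) @ F --> complex.Im l.

Lemma ccvgM f g l m : ccvg f l -> ccvg g m -> ccvg (fun z => f z * g z) (l * m).
Proof.
move=> [fr fi] [gr gi]; rewrite /ccvg !complex_simpE; split.
  under eq_fun do rewrite complex_ReM.
  by apply: cvgB; apply: cvgM.
under eq_fun do rewrite complex_ImM.
by apply: cvgD; apply: cvgM.
Qed.

Lemma ccvg_conj f l : ccvg f l -> ccvg (fun z => Num.conj (f z)) (Num.conj l).
Proof.
move=> [fr fi]; rewrite /ccvg !complex_simpE; split.
  by under eq_fun do rewrite complex_Re_conj.
by under eq_fun do rewrite complex_Im_conj; apply: cvgN.
Qed.

Lemma ccvg_sum (I : Type) (s : seq I) (f : I -> Z -> R[i]) (l : I -> R[i]) :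
  (forall k, ccvg (f k) (l k)) ->
  ccvg (fun z => \sum_(k <- s) f k z) (\sum_(k <- s) l k).
Proof.
move=> fl; elim: s => [|k s [IHr IHi]].
  by split; under eq_fun do rewrite big_nil; rewrite big_nil; exact: cvg_cst.
have [fr fi] := fl k; rewrite big_cons /ccvg !complex_simpE; split.
  by under eq_fun do rewrite big_cons complex_ReD; apply: cvgD.
by under eq_fun do rewrite big_cons complex_ImD; apply: cvgD.
Qed.

Lemma ccvg_sesq (r : nat) (M : Z -> 'M[R[i]]_r) (u w : Z -> 'cV[R[i]]_r)
    (M0 : 'M[R[i]]_r) (u0 w0 : 'cV[R[i]]_r) :
  (forall a b, ccvg (fun z => M z a b) (M0 a b)) ->
  (forall a, ccvg (fun z => u z a 0) (u0 a 0)) ->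
  (forall a, ccvg (fun z => w z a 0) (w0 a 0)) ->
  ccvg (fun z => sesq (M z) (u z) (w z)) (sesq M0 u0 w0).
Proof.
move=> cM cu cw; apply: ccvg_sum => a; apply: ccvg_sum => b.
by apply: ccvgM => //; apply: ccvgM => //; apply: ccvg_conj.
Qed.

End ComplexLimit.

(** * Continuity of Gram matrices in time and point *)

Section MetricContinuity.
Variables (R : realType) (n r : nat) (X : complexManifold R n) (E : holBundle X r).
Implicit Types (h : R -> hermMetric E) (i : chart_idx X) (j : triv_idx E) (x : X).

(** Fibre vectors are parametrised by real row vectors, so that the unit sphere is a closed bounded
    subset of a real coordinate space. *)
Definition ctop (y : 'rV[R]_(r + r)) : 'cV[R[i]]_r :=
  \col_a (y 0 (lshift r a) +i* y 0 (rshift r a))%C.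

Definition metric_fun h j (y : 'rV[R]_(r + r)) (q : R * X) : R :=
  complex.Re (sesq (gram (h q.1) j q.2) (ctop y) (ctop y)).

(** Restricted to nonnegative times, where alone the families are known to be smooth. *)
Definition time_nbhs (s : R) x : set_system (R * X) :=
  within [set q | 0 <= q.1] (nbhs (s, x)).

#[export] Instance time_nbhs_filter s x : Filter (time_nbhs s x).
Proof. exact: within_filter. Qed.

Lemma chart_continuous i x : chart_dom i x -> chart i @ x --> chart i x.
Proof.
move=> ix; have := @chart_cont _ _ X i.
rewrite continuous_open_subspace; last exact: (@chart_dom_open _ _ X i).
by apply; rewrite inE.
Qed.

(** Order 0 of smoothness is continuity within S, the product of the nonnegative times with
    [bundle_img i j]; composition with the chart carries it to X. *)
Lemma gram_cvg h j s x a b : smooth_family h -> 0 <= s -> triv_dom j x ->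
  ccvg (time_nbhs s x) (fun q => gram (h q.1) j q.2 a b) (gram (h s) j x a b).
Proof.
move=> hs s0 jx; have [i ix] := chart_cover x.
pose S := [set q : R * cspace R n | 0 <= q.1 /\ bundle_img i j q.2].
have Sp : S (s, chart i x) by split => //; exists x.
pose phi (q : R * X) := (q.1, chart i q.2).
have near_dom : \forall q \near time_nbhs s x, 0 <= q.1 /\ chart_dom i q.2 /\ triv_dom j q.2.
  rewrite /time_nbhs near_withinE.
  have nx : \forall y \near x, chart_dom i y /\ triv_dom j y.
    apply: filterI; apply: open_nbhs_nbhs; split => //.
      exact: (@chart_dom_open _ _ X i).
    exact: (@triv_dom_open _ _ _ _ E j).
  have nq : nbhs (s, x) (fun q : R * X => chart_dom i q.2 /\ triv_dom j q.2).
    exact: (@cvg_snd _ _ (nbhs s) (nbhs x) _ _ nx).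
  by apply: (@filterS _ _ _ _ _ _ nq) => q.
have phic : phi @ time_nbhs s x --> within S (nbhs (s, chart i x)).
  have c : phi @ nbhs (s, x) --> nbhs (s, chart i x).
    have c1 : (fun q : R * X => q.1) @ nbhs (s, x) --> s by exact: cvg_fst.
    have c2 : (fun q : R * X => chart i q.2) @ nbhs (s, x) --> chart i x.
      exact: (@cvg_comp _ _ _ snd (chart i) (nbhs (s, x)) (nbhs x) _ cvg_snd
        (chart_continuous ix)).
    exact: (cvg_pair c1 c2).
  move=> A AS.
  have AS' : \forall q \near time_nbhs s x, S (phi q) -> A (phi q).
    have cA : nbhs (s, x) (fun q => S (phi q) -> A (phi q)) := c _ AS.
    by apply: (@filterS _ _ _ _ _ _ cA) => q + _.
  suff : \forall q \near time_nbhs s x, A (phi q) by [].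
  apply: filterS2 near_dom AS' => q [q0 [iq jq]]; apply; split => //.
  by exists q.2.
have main (pr : R[i] -> R) :
    smooth_on S (fun q => pr (gram (h q.1) j (chartV i q.2) a b)) ->
    (fun q => pr (gram (h q.1) j q.2 a b)) @ time_nbhs s x --> pr (gram (h s) j x a b).
  move=> /(_ 0%N)[+ _]; rewrite continuous_subspace_in => cS.
  have /cS cp : (s, chart i x) \in S by rewrite inE.
  have cw : (fun q => pr (gram (h q.1) j (chartV i q.2) a b)) @
      within S (nbhs (s, chart i x)) --> pr (gram (h s) j x a b).
    rewrite (nbhs_subspace_in Sp).
    have <- : pr (gram (h (s, chart i x).1) j (chartV i (s, chart i x).2) a b) =
        pr (gram (h s) j x a b) by rewrite /= (chartK ix).
    exact: cp.
  apply: cvg_trans (cvg_comp _ _ phic cw).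
  apply: near_eq_cvg; apply: filterS near_dom => q [_ [iq _]].
  by rewrite /phi /= (chartK iq).
have [sr si] := hs i j a b.
split; [exact: (main (@complex.Re R))|exact: (main (@complex.Im R))].
Qed.

End MetricContinuity.

(** * Openness of strict domination on unit spheres *)

Section StrictComparison.
Variables (R : realType) (n r : nat) (X : complexManifold R n) (E : holBundle X r).
Implicit Types (k : R -> hermMetric E) (j : triv_idx E) (x : X) (y : 'rV[R]_(r + r)).

Lemma ccvg_comp (Z W : Type) (F : set_system Z) (G : set_system W) (phi : Z -> W)
    (f : W -> R[i]) l :
  phi @ F --> G -> ccvg G f l -> ccvg F (fun z => f (phi z)) l.
Proof.
move=> c [fr fi]; split.
  exact: (cvg_comp phi (fun w => complex.Re (f w)) c fr).
exact: (cvg_comp phi (fun w => complex.Im (f w)) c fi).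
Qed.

Lemma ctop_cvg y a : ccvg (nbhs y) (fun z => ctop z a 0) (ctop y a 0).
Proof.
split; rewrite mxE /=.
  by under eq_fun do rewrite mxE /=; exact: coord_continuous.
by under eq_fun do rewrite mxE /=; exact: coord_continuous.
Qed.

Lemma metric_fun_cvg k j s x y : smooth_family k -> 0 <= s -> triv_dom j x ->
  (fun z => metric_fun k j z.1 z.2) @ filter_prod (nbhs y) (time_nbhs s x) -->
  metric_fun k j y (s, x).
Proof.
move=> ks s0 jx.
have c1 a : ccvg (filter_prod (nbhs y) (time_nbhs s x)) (fun z => ctop z.1 a 0)
    (ctop y a 0).
  exact: (ccvg_comp cvg_fst (ctop_cvg y a)).
have c2 a b : ccvg (filter_prod (nbhs y) (time_nbhs s x))
    (fun z => gram (k z.2.1) j z.2.2 a b) (gram (k s) j x a b).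
  exact: (ccvg_comp cvg_snd (gram_cvg a b ks s0 jx)).
by have [] := ccvg_sesq _ c2 c1 c1.
Qed.

Lemma time_nbhs_dom j s x : triv_dom j x ->
  \forall q \near time_nbhs s x, 0 <= q.1 /\ triv_dom j q.2.
Proof.
move=> jx; rewrite /time_nbhs near_withinE.
have nx : \forall z \near x, triv_dom j z.
  by apply: open_nbhs_nbhs; split => //; exact: (@triv_dom_open _ _ _ _ E j).
have nq : nbhs (s, x) (fun q : R * X => triv_dom j q.2).
  exact: (@cvg_snd _ _ (nbhs s) (nbhs x) _ _ nx).
by apply: (@filterS _ _ _ _ _ _ nq) => q.
Qed.

Lemma metric_funZ k j (a : R) y q : metric_fun k j (a *: y) q = a ^+ 2 * metric_fun k j y q.
Proof.
rewrite /metric_fun; have -> : ctop (a *: y) = a%:C%C *: ctop y.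
  apply/matrixP => b c; rewrite !mxE; apply: complex_ext => /=; ring.
rewrite sesqZl sesqZr; case: (sesq _ _ _) => c d /=; ring.
Qed.

Definition real_coord (U : 'cV[R[i]]_r) : 'rV[R]_(r + r) :=
  row_mx (\row_a complex.Re (U a 0)) (\row_a complex.Im (U a 0)).

Lemma real_coordK : cancel real_coord (@ctop R r).
Proof.
move=> U; apply/matrixP => a b; rewrite ord1 !mxE.
by rewrite (unsplitK (inl a)) (unsplitK (inr a)) !mxE; case: (U a 0).
Qed.

Lemma metric_fun_triv k j s x (u : fib E x) : triv_dom j x ->
  metric_fun k j (real_coord (triv j u)) (s, x) = complex.Re (k s x u u).
Proof. by move=> jx; rewrite /metric_fun real_coordK (metric_gram _ u jx). Qed.

Lemma metric_fun_ge0 k j y q : triv_dom j q.2 -> 0 <= metric_fun k j y q.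
Proof.
move=> jq; have := posherm_ge0 (ctop y) (gram_posherm (k q.1) jq).
by rewrite lecE => /andP[].
Qed.

Lemma metric_fun_gt0 k j y q : triv_dom j q.2 -> y != 0 -> 0 < metric_fun k j y q.
Proof.
move=> jq y0; have [_ /(_ (ctop y))] := gram_posherm (k q.1) jq.
have cy0 : ctop y != 0.
  apply: contra y0 => /eqP/matrixP cy; apply/eqP/matrixP => a b; rewrite ord1 mxE.
  rewrite -(splitK b); case: (fintype.split b) => c /=.
    by have := cy c 0; rewrite !mxE => -[].
  by have := cy c 0; rewrite !mxE => -[].
by move=> /(_ cy0); rewrite ltcE => /andP[].
Qed.

Lemma sphere_compact : compact [set y : 'rV[R]_(r + r) | `|y| = 1].
Proof.
apply: bounded_closed_compact.
  by exists 1; split => // M M1 y /= ->; exact: ltW.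
apply: (@preimage_closed _ _ (fun y : 'rV[R]_(r + r) => `|y|) [set 1]).
  by move=> y _; exact: norm_continuous.
exact: closed_eq.
Qed.

Variables (g h : R -> hermMetric E) (eps : R).
Hypotheses (gs : smooth_family g) (hs : smooth_family h) (eps0 : 0 < eps).

(** The constant c is an argument, so that openness can be proved jointly in the vector, the time,
    the point and c. *)
Definition gap j y (qc : (R * X) * R) : R :=
  qc.2 * (1 + eps * qc.1.1) * metric_fun h j y qc.1 - metric_fun g j y qc.1.

Lemma gap_near j s x y c : 0 <= s -> triv_dom j x -> 0 < gap j y ((s, x), c) ->
  \forall z \near y & qc \near filter_prod (time_nbhs s x) (nbhs c), 0 < gap j z qc.
Proof.
move=> s0 jx gpos.
pose F := filter_prod (nbhs y) (filter_prod (time_nbhs s x) (nbhs c)).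
have cq : (fun z => (z.1, z.2.1)) @ F --> filter_prod (nbhs y) (time_nbhs s x).
  have c1 : (fun z : 'rV[R]_(r + r) * ((R * X) * R) => z.1) @ F --> nbhs y.
    exact: cvg_fst.
  have c2 : (fun z : 'rV[R]_(r + r) * ((R * X) * R) => z.2.1) @ F --> time_nbhs s x.
    exact: (cvg_comp _ _ cvg_snd cvg_fst).
  exact: (cvg_pair c1 c2).
have ch : (fun z : 'rV[R]_(r + r) * ((R * X) * R) => metric_fun h j z.1 z.2.1) @ F -->
    metric_fun h j y (s, x).
  exact: (cvg_comp _ _ cq (@metric_fun_cvg h j s x y hs s0 jx)).
have cg : (fun z : 'rV[R]_(r + r) * ((R * X) * R) => metric_fun g j z.1 z.2.1) @ F -->
    metric_fun g j y (s, x).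
  exact: (cvg_comp _ _ cq (@metric_fun_cvg g j s x y gs s0 jx)).
have cc : (fun z : 'rV[R]_(r + r) * ((R * X) * R) => z.2.2) @ F --> c.
  exact: (cvg_comp _ _ cvg_snd cvg_snd).
have cs : (fun z : 'rV[R]_(r + r) * ((R * X) * R) => z.2.1.1) @ F --> s.
  have ct : (fun q : R * X => q.1) @ time_nbhs s x --> s.
    exact: (cvg_trans (cvg_app _ (cvg_within _)) cvg_fst).
  exact: (cvg_comp _ _ (cvg_comp _ _ cvg_snd cvg_fst) ct).
have cgap : (fun z => gap j z.1 z.2) @ F --> gap j y ((s, x), c).
  apply: cvgB cg; apply: cvgM ch; apply: cvgM cc _.
  by apply: cvgD; [exact: cvg_cst|apply: cvgM cs; exact: cvg_cst].
exact: (cvgr_gt _ cgap _ gpos).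
Qed.

Lemma gap_le j y q c c' : 0 <= q.1 -> triv_dom j q.2 -> c <= c' ->
  gap j y (q, c) <= gap j y (q, c').
Proof.
move=> q0 jq cc; rewrite /gap /= lerD2r ler_wpM2r ?metric_fun_ge0 //.
by rewrite ler_wpM2r // addr_ge0 // mulr_ge0 // ltW.
Qed.

(** Compactness of the sphere turns the neighbourhoods of [gap_near], which depend on y, into one
    that serves all y. *)
Lemma gap_sphere_near j s x c : 0 <= s -> triv_dom j x ->
  (forall y, `|y| = 1 -> 0 < gap j y ((s, x), c)) ->
  \forall qc \near filter_prod (time_nbhs s x) (nbhs c),
    forall y, `|y| = 1 -> 0 < gap j y qc.
Proof.
move=> s0 jx gpos.
have /compact_near_coveringP/(_ _ _ (fun qc y => 0 < gap j y qc)) := sphere_compact.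
apply => y /= y1; exact: gap_near (gpos y y1).
Qed.

(** For each y some c makes the gap equal to 1. The gap stays positive at this c near y and (s, x),
    and it does not decrease as c grows; compactness of the sphere then gives uniformity in y. *)
Lemma gap_sphere_pinfty j s x : 0 <= s -> triv_dom j x ->
  \forall qc \near filter_prod (time_nbhs s x) +oo%R,
    forall y, `|y| = 1 -> 0 < gap j y qc.
Proof.
move=> s0 jx.
have /compact_near_coveringP/(_ _ _ (fun qc y => 0 < gap j y qc)) := sphere_compact.
apply => y /= y1.
have y0 : y != 0 by rewrite -normr_eq0 y1 oner_eq0.
have hy := metric_fun_gt0 h (q := (s, x)) jx y0.
have sp : 0 < 1 + eps * s by rewrite ltr_pwDl // mulr_ge0 // ltW.
pose c := (metric_fun g j y (s, x) + 1) / ((1 + eps * s) * metric_fun h j y (s, x)).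
have gc : 0 < gap j y ((s, x), c).
  rewrite /gap /= -mulrA divfK ?mulf_neq0 ?gt_eqF //.
  by rewrite addrAC subrr add0r.
have [[A B] /= [nA [[C D] /= [nC nD] CD]] AB] := gap_near s0 jx gc.
exists (A, [set qc : (R * X) * R | (C qc.1 /\ 0 <= qc.1.1 /\ triv_dom j qc.1.2) /\ c <= qc.2]).
  split => //=; exists ([set q | C q /\ 0 <= q.1 /\ triv_dom j q.2], [set d | c <= d]).
    split => /=; first by apply: filterI nC (time_nbhs_dom s jx).
    by apply: nbhs_pinfty_ge; exact: num_real.
  by move=> [q d] /= [].
move=> [z [q d]] /= [Az [[Cq [q0 jq]] cd]].
apply: lt_le_trans (gap_le z q0 jq cd).
apply: (AB (z, (q, c))); split => //=.
by apply: (CD (q, c)); split => //=; exact: nbhs_singleton.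
Qed.

End StrictComparison.

(** * The continuity argument in the constant C *)

Section Comparison.
Variables (R : realType) (n r : nat) (X : complexManifold R n) (E : holBundle X r).

Definition strictly_below (g h : R -> hermMetric E) (eps T c : R) :=
  forall s x (u : fib E x), 0 <= s <= T -> u != 0 ->
  complex.Re (g s x u u) < c * (1 + eps * s) * complex.Re (h s x u u).

(** Both sides are homogeneous of degree 2, so the unit sphere decides. *)
Lemma gap_triv (g h : R -> hermMetric E) eps j s x c (u : fib E x) :
  triv_dom j x -> u != 0 ->
  (forall y, `|y| = 1 -> 0 < gap g h eps j y ((s, x), c)) ->
  complex.Re (g s x u u) < c * (1 + eps * s) * complex.Re (h s x u u).
Proof.
move=> jx u0 gpos; pose y := real_coord (triv j u).
have y0 : y != 0.
  apply: contra u0 => /eqP y0; rewrite (triv_frame u jx) big1 // => b _.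
  have -> : triv j u = ctop y by rewrite /y real_coordK.
  rewrite y0 !mxE; have -> : (0 +i* 0)%C = 0 :> R[i] by [].
  by rewrite scale0r.
have yE : y = `|y| *: (`|y|^-1 *: y) by rewrite scalerA mulfV ?normr_eq0 // scale1r.
have y1 : `| `|y|^-1 *: y | = 1.
  by rewrite normrZ normfV normr_id mulVf // normr_eq0.
have := gpos _ y1; rewrite /gap /= => gy.
have yZ k : metric_fun k j y (s, x) = `|y| ^+ 2 * metric_fun k j (`|y|^-1 *: y) (s, x).
  by rewrite {1}yE metric_funZ.
rewrite -!(metric_fun_triv _ s u jx) -/y !yZ -subr_gt0.
move: gy; set a := metric_fun h _ _ _; set b := metric_fun g _ _ _ => gy.
have -> : c * (1 + eps * s) * (`|y| ^+ 2 * a) - `|y| ^+ 2 * b =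
  `|y| ^+ 2 * (c * (1 + eps * s) * a - b) by ring.
by rewrite mulr_gt0 // exprn_gt0 // normr_gt0.
Qed.

Hypothesis X_compact : compact [set: X].

(** Compactness of the product of [0, T] and X makes the local statements uniform. The filter F is
    arbitrary so as to cover [nbhs c], for openness, and [+oo], for the existence of an admissible
    constant. *)
Lemma strictly_below_near (g h : R -> hermMetric E) (eps T : R) (F : set_system R)
    {FF : Filter F} :
  (forall s x, 0 <= s <= T -> \forall qc \near filter_prod (time_nbhs s x) F,
    forall y, `|y| = 1 -> 0 < gap g h eps (triv_at E x) y qc) ->
  \forall c \near F, strictly_below g h eps T c.
Proof.
move=> gF.
have cK : compact (`[0, T]%classic `*` [set: X]).
  by apply: compact_setX => //; exact: segment_compact.
(* The guard [0 <= q.1] turns a statement about [time_nbhs] into one about full neighbourhoods in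
   the product. *)
pose P c (q : R * X) := 0 <= q.1 -> forall u : fib E q.2, u != 0 ->
  complex.Re (g q.1 q.2 u u) < c * (1 + eps * q.1) * complex.Re (h q.1 q.2 u u).
have : \forall c \near F, `[0, T]%classic `*` [set: X] `<=` P c.
  move/compact_near_coveringP : cK; apply => -[s x] [/= sT _].
  have jx := triv_cover E x.
  have sT' : 0 <= s <= T by move: sT; rewrite in_itv.
  have [[A B] /= [nA nB] AB] := gF s x sT'.
  have nA' := filterI nA (time_nbhs_dom s jx).
  exists ([set q | 0 <= q.1 -> A q /\ 0 <= q.1 /\ triv_dom (triv_at E x) q.2], B).
    by split; [exact: nA'|exact: nB].
  move=> [[t z] c] /= [Aq Bc] t0 u u0.
  have [Atz [_ jz]] := Aq t0.
  apply: (gap_triv jz u0) => y y1; exact: (AB ((t, z), c) (conj Atz Bc) y y1).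
apply: filterS => c Kc s x u /andP[s0 sT] u0.
by apply: (Kc (s, x)) => //; split => //=; rewrite in_itv /= s0.
Qed.

Lemma metric_Re (k : hermMetric E) x (u : fib E x) :
  k x u u = (complex.Re (k x u u))%:C%C.
Proof.
have jx := triv_cover E x.
have := posherm_ge0 (triv (triv_at E x) u) (gram_posherm k jx).
rewrite -(metric_gram k u jx) => /ger0_Im Im0.
by apply: complex_ext => /=.
Qed.

Lemma metric_Re_gt0 (k : hermMetric E) x (u : fib E x) : u != 0 ->
  0 < complex.Re (k x u u).
Proof.
move=> u0; have : 0 < k x u u by exact: neq0_dnorm_gt0.
by rewrite ltcE => /andP[].
Qed.

Lemma metric0 (k : hermMetric E) x : k x 0 0 = 0.
Proof. by rewrite linear0l. Qed.

Variable w : kahlerForm X.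
Variables g h : R -> hermMetric E.
Hypotheses (gf : hermitian_YM_flow w g) (hf : hermitian_YM_flow w h).
Hypothesis le0 : metric_le (g 0) (h 0).

Lemma strictly_belowS eps T c c' : 0 < eps -> c <= c' ->
  strictly_below g h eps T c -> strictly_below g h eps T c'.
Proof.
move=> e0 cc bc s x u sT u0; apply: lt_le_trans (bc s x u sT u0) _.
have /andP[s0 _] := sT.
apply: ler_wpM2r; first exact/ltW/metric_Re_gt0.
by apply: ler_wpM2r => //; rewrite addr_ge0 // mulr_ge0 // ltW.
Qed.

(** Each unit y is the coordinate vector of a nonzero fibre vector, so strict domination makes the
    gap positive on every sphere. *)
Lemma strictly_below_open eps T c : 0 < eps -> strictly_below g h eps T c ->
  \forall d \near c, strictly_below g h eps T d.
Proof.
move=> e0 bc; have [[gs _] [hs _]] := (gf, hf).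
apply: (@strictly_below_near g h eps T (nbhs c) (nbhs_filter c)) => s x sT; have jx := triv_cover E x.
have /andP[s0 _] := sT.
apply: (gap_sphere_near gs hs s0 jx) => y y1.
pose u := trivV (triv_at E x) x (ctop y).
have tu : triv (triv_at E x) u = ctop y by rewrite trivVK.
have y0 : y != 0 by rewrite -normr_eq0 y1 oner_eq0.
have hy := metric_fun_gt0 h (q := (s, x)) jx y0.
have mE k : metric_fun k (triv_at E x) y (s, x) = complex.Re (k s x u u).
  by rewrite /metric_fun -tu -(metric_gram _ u jx).
rewrite /gap /= !mE subr_gt0; apply: bc => //.
apply/eqP => u0; move: hy; rewrite mE u0 metric0 /=.
by rewrite ltxx.
Qed.

(** If some c > 1 failed, let c0 be the infimum of the admissible constants. Strict domination fails
    at c0 by openness, while the non-strict one survives as a limit, so some vector touches. Time 0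
    is excluded by c0 > 1 and [le0], positive times by [no_touching]. *)
Lemma strictly_below_all eps T c : 0 < eps -> 1 < c -> strictly_below g h eps T c.
Proof.
move=> e0 c1; have [[gs _] [hs _]] := (gf, hf).
apply: contrapT => nc.
pose Z : set R := [set d | strictly_below g h eps T d].
have [d Zd] : exists d, Z d.
  have : \forall d \near +oo, strictly_below g h eps T d.
    apply: (@strictly_below_near g h eps T +oo%R _) => s x /andP[s0 _].
    by apply: (gap_sphere_pinfty gs hs e0 s0); exact: triv_cover.
  by move=> /filter_ex[d]; exists d.
have cZ : lbound Z c.
  move=> z Zz; rewrite leNgt; apply/negP => zc; apply: nc.
  exact: strictly_belowS (ltW zc) Zz.
have hi : has_inf Z by split; [exists d|exists c].
pose c0 := inf Z.
have cc0 : c <= c0 by apply: lb_le_inf cZ; exists d.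
(* If c0 were admissible, so would be a slightly smaller constant. *)
have nc0 : ~ strictly_below g h eps T c0.
  move=> /(strictly_below_open e0) /nbhs_ballP[e /= e_gt0 eZ].
  have : Z (c0 - e / 2).
    apply: eZ; rewrite /ball /= opprB addrC subrK gtr0_norm ?divr_gt0 //.
    by rewrite ltr_pdivrMr // ltr_pMr // ltr1n.
  move=> /(ge_inf (proj2 hi)); rewrite -/c0 leNgt => /negP; apply.
  by rewrite ltrBlDr ltrDl divr_gt0.
have gt_c0 z : c0 < z -> strictly_below g h eps T z.
  move=> cz; have zc0 : 0 < z - c0 by rewrite subr_gt0.
  have [y Zy] := inf_adherent zc0 hi.
  by rewrite addrC subrK => yz; exact: strictly_belowS (ltW yz) Zy.
have c0_gt0 : 0 < c0 by apply: lt_le_trans cc0; apply: lt_trans c1.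
have c0_gt1 : 1 < c0 by apply: lt_le_trans cc0.
have below0 s x (u : fib E x) : 0 <= s <= T ->
    complex.Re (g s x u u) <= c0 * (1 + eps * s) * complex.Re (h s x u u).
  move=> sT; have [->|u0] := eqVneq u 0; first by rewrite !metric0 /= mulr0.
  have hp := metric_Re_gt0 (h s) u0; have /andP[s0 _] := sT.
  have ep : 0 < 1 + eps * s by rewrite ltr_pwDl // mulr_ge0 // ltW.
  apply/ler_addgt0Pr => e e_gt0.
  (* Chosen so that the bound for z exceeds the bound for c0 by exactly e. *)
  pose z := c0 + e / ((1 + eps * s) * complex.Re (h s x u u)).
  have cz : c0 < z by rewrite ltrDl divr_gt0 // mulr_gt0.
  apply: ltW; apply: lt_le_trans (gt_c0 z cz s x u sT u0) _.
  by rewrite /z -[X in X <= _]mulrA mulrDl divfK ?mulrA // gt_eqF // mulr_gt0.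
apply: nc0 => s x u sT u0; rewrite lt_neqAle below0 // andbT.
apply/eqP => touch; have /andP[s0 s_le] := sT.
have := s0; rewrite le_eqVlt => /orP[/eqP sE|s_gt0].
  move: touch; rewrite -sE mulr0 addr0 mulr1 => touch.
  have := le0 u; rewrite (metric_Re (g 0)) (metric_Re (h 0)) lecR touch.
  have hp := metric_Re_gt0 (h 0) u0.
  by rewrite ger_pMl // leNgt c0_gt1.
apply: (no_touching gf hf c0_gt0 e0 s_gt0 u0 _ (x := x)).
  move=> t y z /andP[t0 ts]; rewrite (metric_Re (g t)) (metric_Re (h t)) -rmorphM lecR.
  by apply: below0; rewrite t0 (le_trans ts).
by rewrite (metric_Re (g s)) (metric_Re (h s)) -rmorphM touch.
Qed.

(** [strictly_below_all] with eps = d and C = 1 + d, as d tends to 0. *)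
Lemma flow_metric_le t : 0 <= t -> metric_le (g t) (h t).
Proof.
move=> t0 x u; have [->|u0] := eqVneq u 0; first by rewrite !metric0.
rewrite (metric_Re (g t)) (metric_Re (h t)) lecR.
have hp := metric_Re_gt0 (h t) u0.
set a := complex.Re (h t x u u) in hp *; set b := complex.Re _.
apply/ler_addgt0Pr => e e_gt0.
(* As d <= 1, the excess of (1 + d) (1 + d t) a over a is at most d a (1 + 2 t), which this choice
   bounds by e. *)
pose d := Num.min 1 (e / (a * (1 + t + t))).
have den : 0 < a * (1 + t + t) by rewrite mulr_gt0 // -addrA ltr_pwDl // addr_ge0.
have d0 : 0 < d by rewrite lt_min ltr01 divr_gt0.
have [d1 de] : d <= 1 /\ d <= e / (a * (1 + t + t)).
  by rewrite /d !ge_min !lexx orbT.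
have d1' : 1 < 1 + d by rewrite ltrDl.
have tt : 0 <= t <= t by rewrite t0 lexx.
have := strictly_below_all (T := t) d0 d1' tt u0; rewrite -/a -/b => lt_b.
apply: ltW; apply: lt_le_trans lt_b _.
move: de; rewrite ler_pdivlMr // => de.
have dd : d * d * t * a <= d * t * a.
  by rewrite ler_wpM2r ?(ltW hp) // ler_wpM2r // ler_piMl // ltW.
have -> : (1 + d) * (1 + d * t) * a = a + (d * a + d * t * a + d * d * t * a) by ring.
rewrite lerD2l; apply: le_trans de.
have -> : d * (a * (1 + t + t)) = d * a + d * t * a + d * t * a by ring.
by rewrite lerD2l.
Qed.

End Comparison.

Theorem proposition4p3 (R : realType) (n r : nat) (X : complexManifold R n)
    (X_compact : compact [set: X]) (w : kahlerForm X) (E : holBundle X r)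
    (g h : R -> hermMetric E)
    (g_flow : hermitian_YM_flow w g) (h_flow : hermitian_YM_flow w h)
    (le0 : metric_le (g 0) (h 0)) :
  forall t : R, 0 <= t -> metric_le (g t) (h t).
Proof. exact: (flow_metric_le X_compact g_flow h_flow le0). Qed.
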